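(* Let $\Delta_T>0$ with $\Delta_T\to\Delta_\infty\in(0,\infty)$ as $T\to\infty$. Then for every $\vartheta\in\Theta$ the family of experiments $(\mathcal E^{T,\Delta_T})_{T>0}$ satisfies the LAN property at $\vartheta$ with normalisation $$I_{T,\Delta_\infty}(\vartheta)=T\,\Delta_\infty\,\varphi(\vartheta,\Delta_\infty)=T\Delta_\infty\,\mathbb E_\vartheta\Big[\big(h_{\Delta_\infty}(\vartheta,X_{\Delta_\infty})+(\vartheta\Delta_\infty)^{-1}|X_{\Delta_\infty}|-1\big)^2\Big],$$ and $I_{T,\Delta_T}(\vartheta)\sim I_{T,\Delta_\infty}(\vartheta)$ (ratio tends to $1$) as $T\to\infty$.
   Context: Model: $\Theta\subseteq(0,\infty)$ is an open parameter set. Under $\mathbb P_\vartheta$, $X_t=\sum_{i=1}^{N_t}\varepsilon_i$ ($X_0=0$), where $(N_t)$ is a homogeneous Poisson process of intensity $\vartheta$ and the $\varepsilon_i$ are i.i.d., independent of $(N_t)$, with $\mathbb P(\varepsilon_i=1)=\mathbb P(\varepsilon_i=-1)=1/2$. For $T>0$ and $0<\Delta\le T$, the experiment $\mathcal E^{T,\Delta}=\{\mathbb P^{T,\Delta}_\vartheta,\vartheta\in\Theta\}$ consists of the law $\mathbb P^{T,\Delta}_\vartheta$ of the observation $(X_0,X_\Delta,X_{2\Delta},\dots,X_{\lfloor T/\Delta\rfloor\Delta})$. The increment law is $f_\Delta(\vartheta,k)=\mathbb P_\vartheta(X_\Delta=k)=e^{-\vartheta\Delta}\mathcal I_{|k|}(\vartheta\Delta)$,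 $k\in\mathbb Z$, where $\mathcal I_\nu(x)=\sum_{m\ge0}\frac{(x/2)^{2m+\nu}}{m!\,\Gamma(\nu+m+1)}$ is the modified Bessel function of the first kind. Set $h_\Delta(\vartheta,k)=\mathcal I_{|k|+1}(\vartheta\Delta)/\mathcal I_{|k|}(\vartheta\Delta)$ and $\varphi(\vartheta,\Delta)=\mathbb E_\vartheta\big[\big(h_\Delta(\vartheta,X_\Delta)+(\vartheta\Delta)^{-1}|X_\Delta|-1\big)^2\big]$. LAN: the family $(\mathcal E^{T,\Delta_T})_{T>0}$ satisfies the LAN property at $\vartheta$ with normalisation $I_T(\vartheta)>0$ if for every $v\in\mathbb R$ with $\vartheta+vI_T(\vartheta)^{-1/2}\in\Theta$, $\frac{d\mathbb P^{T,\Delta_T}_{\vartheta+vI_T(\vartheta)^{-1/2}}}{d\mathbb P^{T,\Delta_T}_\vartheta}=\exp(v\xi_T-\tfrac12v^2+r_T)$, where $\xi_T\to\mathcal N(0,1)$ in distribution and $r_T\to0$ in probability under $\mathbb P^{T,\Delta_T}_\vartheta$ as $T\to\infty$. *)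

(* Defs.v *)
From Stdlib Require Import Reals Lra ZArith List ClassicalEpsilon.
Open Scope R_scope.

(** Limit of a real sequence (chosen by classical epsilon; it is the actual
    limit whenever the sequence converges). *)
Definition lim_seq (u : nat -> R) : R :=
  epsilon (inhabits 0) (fun l => Un_cv u l).

Definition sumZ (g : Z -> R) : R :=
  lim_seq (fun M => sum_f_R0 (fun j => g (Z.of_nat j - Z.of_nat M)%Z) (2 * M)).

(** Modified Bessel function of the first kind I_nu(x) for integer order nu >= 0
    (Gamma(nu+m+1) = (nu+m)!). *)
Definition besselI (nu : nat) (x : R) : R :=
  lim_seq (fun N => sum_f_R0
    (fun m => (x / 2) ^ (2 * m + nu) / (INR (fact m) * INR (fact (nu + m)))) N).

(** Increment law f_Delta(theta,k) = P_theta(X_Delta = k). *)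
Definition fD (Delta theta : R) (k : Z) : R :=
  exp (- (theta * Delta)) * besselI (Z.abs_nat k) (theta * Delta).

Definition hD (Delta theta : R) (k : Z) : R :=
  besselI (S (Z.abs_nat k)) (theta * Delta) / besselI (Z.abs_nat k) (theta * Delta).

Definition phi (theta Delta : R) : R :=
  sumZ (fun k => fD Delta theta k *
                 (hD Delta theta k + IZR (Z.abs k) / (theta * Delta) - 1) ^ 2).

Definition nobs (T Delta : R) : nat := Z.to_nat (Int_part (T / Delta)).

(** Observation (X_0, X_Delta, ..., X_{n Delta}) from the increments k. *)
Fixpoint psums (s : Z) (k : list Z) : list Z :=
  match k with
  | nil => nil
  | a :: t => (s + a)%Z :: psums (s + a)%Z t
  end.
Definition obs (k : list Z) : list Z := 0%Z :: psums 0%Z k.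

Fixpoint diffs (x : list Z) : list Z :=
  match x with
  | a :: ((b :: _) as t) => (b - a)%Z :: diffs t
  | _ => nil
  end.

Definition prod_f (Delta theta : R) (k : list Z) : R :=
  fold_right (fun a acc => fD Delta theta a * acc) 1 k.

Definition law_pmf (T Delta theta : R) (x : list Z) : R :=
  match x with
  | 0%Z :: _ => if Nat.eqb (length x) (S (nobs T Delta))
                then prod_f Delta theta (diffs x) else 0
  | _ => 0
  end.

Definition lik_ratio (T Delta theta' theta : R) (x : list Z) : R :=
  law_pmf T Delta theta' x / law_pmf T Delta theta x.

Fixpoint boxsum (n M : nat) (g : list Z -> R) : R :=
  match n with
  | O => g nil
  | S n' => sum_f_R0 (fun j => boxsum n' M
                        (fun ks => g ((Z.of_nat j - Z.of_nat M)%Z :: ks))) (2 * M)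
  end.

Definition expect (T Delta theta : R) (g : list Z -> R) : R :=
  lim_seq (fun M => boxsum (nobs T Delta) M
                      (fun k => prod_f Delta theta k * g (obs k))).

Definition ind (b : bool) : R := if b then 1 else 0.

Definition Rle_b (a b : R) : bool := if Rle_dec a b then true else false.

Definition gauss (t : R) : R := exp (- (t ^ 2) / 2) / sqrt (2 * PI).

Lemma gauss_continuity : continuity gauss.
Proof.
  unfold gauss. intros x.
  apply continuity_pt_div.
  - apply (continuity_pt_comp (fun t => - (t ^ 2) / 2) exp).
    + apply continuity_pt_div.
      * apply continuity_pt_opp. apply derivable_continuous_pt.
        apply derivable_pt_pow.
      * apply continuity_pt_const. intros a b; reflexivity.
      * lra.
    + apply derivable_continuous_pt. apply derivable_pt_exp.
  - apply continuity_pt_const. intros a b; reflexivity.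
  - apply Rgt_not_eq. apply sqrt_lt_R0. pose proof PI_RGT_0. lra.
Qed.

Definition int_gauss (a b : R) (H : a <= b) : R :=
  RiemannInt (@continuity_implies_RiemannInt gauss a b H
                (fun x _ => gauss_continuity x)).

Definition Phi (x : R) : R :=
  match Rle_dec 0 x with
  | left H => / 2 + int_gauss 0 x H
  | right H => / 2 - int_gauss x 0 (Rlt_le _ _ (Rnot_le_lt _ _ H))
  end.

Definition lim_T (u : R -> R) (l : R) : Prop :=
  forall eps, eps > 0 -> exists T0, forall T, T >= T0 -> Rabs (u T - l) < eps.

Definition conv_dist_std_normal (DeltaT : R -> R) (theta : R)
    (xi : R -> list Z -> R) : Prop :=
  forall x, lim_T (fun T => expect T (DeltaT T) theta
                              (fun o => ind (Rle_b (xi T o) x))) (Phi x).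

Definition conv_prob_zero (DeltaT : R -> R) (theta : R)
    (r : R -> list Z -> R) : Prop :=
  forall eps, eps > 0 ->
    lim_T (fun T => expect T (DeltaT T) theta
                      (fun o => ind (negb (Rle_b (Rabs (r T o)) eps)))) 0.

(** LAN property at theta with normalisation I_T. The LAN identity is required
    for every possible increment vector (each has positive P_theta-mass, so this
    is the P_theta-a.s. identity of the densities). *)
Definition LAN (Theta : R -> Prop) (DeltaT : R -> R) (theta : R)
    (I : R -> R) : Prop :=
  (forall T, T > 0 -> I T > 0) /\
  exists (xi : R -> list Z -> R) (r : R -> R -> list Z -> R),
    (forall v T, T > 0 -> Theta (theta + v / sqrt (I T)) ->
       forall k : list Z, length k = nobs T (DeltaT T) ->
         lik_ratio T (DeltaT T) (theta + v / sqrt (I T)) theta (obs k)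
         = exp (v * xi T (obs k) - / 2 * v ^ 2 + r v T (obs k))) /\
    conv_dist_std_normal DeltaT theta xi /\
    (forall v, conv_prob_zero DeltaT theta (r v)).

Definition open_param_set (Theta : R -> Prop) : Prop :=
  forall th, Theta th -> 0 < th /\
    exists d, d > 0 /\ forall y, Rabs (y - th) < d -> Theta y.

(* Main.v *)
From Coquelicot Require Import Coquelicot.
From Stdlib Require Import Reals ZArith List Lra Lia Psatz ClassicalEpsilon.
Require Import Defs.
Open Scope R_scope.

(** The increment law and the score depend on [theta] and [Delta] only through
    [x = theta * Delta]: writing [pmf x k = exp (- x) I_|k|(x)], the recurrences of the
    Bessel functions give both [d/dx ln (pmf x k) = score x k] and the Kolmogorov equation
    [d/dx (pmf x k) = (pmf x (k-1) + pmf x (k+1)) / 2 - pmf x k].  Summed over [|k| <= M],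
    the right-hand side telescopes to boundary terms, so that the mass is [1], the score is
    centred, and [E score' = - E (score^2)].

    The log-likelihood ratio is expanded to third order in the step
    [s = Delta / sqrt I]: the linear term is the central sequence, the quadratic one tends
    to [- v^2 / 2] by Chebyshev's inequality, and the cubic one vanishes because the
    derivatives of the score grow at most linearly in [|k|].

    The central limit theorem for the triangular array of scores is Stein's method: for a
    smooth approximation [g] of the indicator of [(-oo, a]], the solution [F] of
    [F' t - t F t = g t - E g(Z)] has bounded second derivative, and
    [E (F' (S) - S F (S))] is [O(n^(-1/2))] for a normalised i.i.d. sum [S].

    All expectations are taken under the restriction of the law to a box [[-M, M]^n], a
    finite sub-probability; the limit [M -> oo] is taken at the end, for each fixed [T]. *)

(** * Iterated positive functionals *)

(** The normalisation is a Fisher information: one increment carries [fisher x] about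
    [x = theta * Delta], hence [Delta ^ 2 * fisher x] about [theta], and there are about [T / Delta]
    increments. As [x] moves with [T], all constants are made uniform for [x] in a compact interval
    around [theta * Dinf].

    The order of limits shapes the estimates. On a box the mass [m0] may be below one and the mean
    [m1] of the score need not vanish, so defects in [1 - m0] and [m1] enter everywhere, with
    factors such as [n ^ 2 * d ^ 4] for a step [d] with [n * d ^ 2] of order one. These are not
    small for large [T]; they disappear only because [M -> oo] comes first, at fixed [n]. Moreover
    [expect] is an epsilon-chosen limit, meaningful only where convergence is proved, so
    inequalities are established for finite sums and then passed to the limit.

    Stein's method suits this setting, since it compares finite sums by Taylor expansion, without
    characteristic functions. Its price is a bound on the Stein solution, hence the Gaussian
    integral and the Mills ratio, derived from the definition of [Phi]. *)

Record positive_linear (A : (Z -> R) -> R) : Prop := {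
  pl_le : forall f g, (forall k, f k <= g k) -> A f <= A g;
  pl_plus : forall f g, A (fun k => f k + g k) = A f + A g;
  pl_scal : forall c f, A (fun k => c * f k) = c * A f }.

Lemma pl_ext A : positive_linear A ->
  forall f g, (forall k, f k = g k) -> A f = A g.
Proof.
  intros HA f g H. apply Rle_antisym; apply (pl_le A HA); intros k; rewrite H; lra.
Qed.

Lemma pl_const A : positive_linear A -> forall c, A (fun _ => c) = c * A (fun _ => 1).
Proof.
  intros HA c. rewrite <- (pl_scal A HA). apply (pl_ext A HA). intros; ring.
Qed.

Lemma pl_minus A : positive_linear A ->
  forall f g, A (fun k => f k - g k) = A f - A g.
Proof.
  intros HA f g.
  rewrite (pl_ext A HA _ (fun k => f k + (-1) * g k)) by (intros; ring).
  rewrite (pl_plus A HA), (pl_scal A HA). ring.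
Qed.

Lemma pl_abs A : positive_linear A ->
  forall f g, (forall k, Rabs (f k) <= g k) -> Rabs (A f) <= A g.
Proof.
  intros HA f g H. apply Rabs_le. split.
  - replace (- A g) with (A (fun k => (-1) * g k)) by (rewrite (pl_scal A HA); ring).
    apply (pl_le A HA). intros k. specialize (H k). apply Rabs_le_between in H. lra.
  - apply (pl_le A HA). intros k. specialize (H k). apply Rabs_le_between in H. lra.
Qed.

Lemma pl_nonneg A : positive_linear A -> forall f, (forall k, 0 <= f k) -> 0 <= A f.
Proof.
  intros HA f H. replace 0 with (A (fun _ => 0)).
  - apply (pl_le A HA). exact H.
  - rewrite (pl_const A HA). ring.
Qed.

(** Expectation under an n-fold product, by recursion on the first coordinate: inductions on [n]
    condition on one increment, and no Fubini argument is involved. *)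
Fixpoint iter_expect (A : (Z -> R) -> R) (n : nat) (G : list Z -> R) : R :=
  match n with
  | O => G nil
  | S n' => A (fun a => iter_expect A n' (fun l => G (a :: l)))
  end.

Section IterExpect.
Variable A : (Z -> R) -> R.
Hypothesis HA : positive_linear A.

Lemma ie_le n : forall G H, (forall l, length l = n -> G l <= H l) ->
  iter_expect A n G <= iter_expect A n H.
Proof.
  induction n as [|n IH]; intros G H HGH; simpl.
  - apply HGH. reflexivity.
  - apply (pl_le A HA). intros k. apply IH. intros l Hl. apply HGH. simpl. lia.
Qed.

Lemma ie_ext n G H : (forall l, length l = n -> G l = H l) ->
  iter_expect A n G = iter_expect A n H.
Proof.
  intros HGH. apply Rle_antisym; apply ie_le; intros l Hl; rewrite (HGH l Hl); lra.
Qed.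

Lemma ie_plus n : forall G H,
  iter_expect A n (fun l => G l + H l) = iter_expect A n G + iter_expect A n H.
Proof.
  induction n as [|n IH]; intros G H; simpl; auto.
  rewrite <- (pl_plus A HA). apply (pl_ext A HA). intros k.
  apply (IH (fun l => G (k :: l)) (fun l => H (k :: l))).
Qed.

Lemma ie_scal n : forall c G,
  iter_expect A n (fun l => c * G l) = c * iter_expect A n G.
Proof.
  induction n as [|n IH]; intros c G; simpl; auto.
  rewrite <- (pl_scal A HA). apply (pl_ext A HA). intros k.
  apply (IH c (fun l => G (k :: l))).
Qed.

Lemma ie_minus n G H :
  iter_expect A n (fun l => G l - H l) = iter_expect A n G - iter_expect A n H.
Proof.
  rewrite (ie_ext n _ (fun l => G l + (-1) * H l)) by (intros; ring).
  rewrite ie_plus, ie_scal. ring.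
Qed.

Lemma ie_abs n G H : (forall l, length l = n -> Rabs (G l) <= H l) ->
  Rabs (iter_expect A n G) <= iter_expect A n H.
Proof.
  intros HGH. apply Rabs_le. split.
  - replace (- iter_expect A n H) with (iter_expect A n (fun l => (-1) * H l))
      by (rewrite ie_scal; ring).
    apply ie_le. intros l Hl. specialize (HGH l Hl). apply Rabs_le_between in HGH. lra.
  - apply ie_le. intros l Hl. specialize (HGH l Hl). apply Rabs_le_between in HGH. lra.
Qed.

Lemma ie_const n c : iter_expect A n (fun _ => c) = c * A (fun _ => 1) ^ n.
Proof.
  induction n as [|n IH]; simpl; [ring|].
  rewrite (pl_ext A HA _ (fun _ => c * A (fun _ => 1) ^ n)) by (intros; apply IH).
  rewrite (pl_const A HA). ring.
Qed.

Hypothesis mass_le : A (fun _ => 1) <= 1.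

Lemma mass_ge : 0 <= A (fun _ => 1).
Proof. apply (pl_nonneg A HA). intros; lra. Qed.

Lemma mass_pow_le n : 0 <= A (fun _ => 1) ^ n <= 1.
Proof.
  pose proof mass_ge. split; [apply pow_le; auto|].
  eapply Rle_trans; [apply (pow_incr _ 1)|rewrite pow1; lra]; auto.
Qed.

Lemma ie_abs_bound n G c : (forall l, length l = n -> Rabs (G l) <= c) -> 0 <= c ->
  Rabs (iter_expect A n G) <= c.
Proof.
  intros H Hc. eapply Rle_trans; [apply (ie_abs n G (fun _ => c)); auto|].
  rewrite ie_const. pose proof (mass_pow_le n). nra.
Qed.

Definition lsum (w : Z -> R) (l : list Z) : R := fold_right (fun a acc => w a + acc) 0 l.

Variable w : Z -> R.
Let m0 := A (fun _ => 1).
Let m1 := A w.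
Let m2 := A (fun k => w k ^ 2).

(** Each coordinate contributes [m1] times a power of [m0 <= 1]. For a centred [w] this measures the
    bias left by truncation. *)
Lemma ie_lsum_abs n : Rabs (iter_expect A n (lsum w)) <= INR n * Rabs m1.
Proof.
  induction n as [|n IH].
  - simpl. rewrite Rabs_R0. lra.
  - simpl iter_expect.
    rewrite (pl_ext A HA _ (fun a => m0 ^ n * w a + iter_expect A n (lsum w))).
    2:{ intros k. rewrite (ie_plus n (fun _ => w k) (lsum w)), ie_const. unfold m0. ring. }
    rewrite (pl_plus A HA), (pl_scal A HA), (pl_const A HA).
    fold m1. fold m0. rewrite S_INR.
    eapply Rle_trans; [apply Rabs_triang|]. rewrite !Rabs_mult.
    pose proof (mass_pow_le n) as Hm. fold m0 in Hm. pose proof mass_ge as H0. fold m0 in H0.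
    fold m0 in mass_le. rewrite (Rabs_pos_eq (m0 ^ n)) by lra. rewrite (Rabs_pos_eq m0) by lra.
    pose proof (Rabs_pos m1). pose proof (Rabs_pos (iter_expect A n (lsum w))). nra.
Qed.

(** The diagonal terms give [n * m2]; the off-diagonal ones, zero for an exactly centred law, are at
    most [m1 ^ 2] each. *)
Lemma ie_lsum_sq n :
  iter_expect A n (fun l => lsum w l ^ 2) <= INR n * m2 + INR n ^ 2 * m1 ^ 2.
Proof.
  induction n as [|n IH].
  - simpl. lra.
  - simpl iter_expect.
    rewrite (pl_ext A HA _ (fun a => m0 ^ n * w a ^ 2 + ((2 * iter_expect A n (lsum w)) * w a
               + iter_expect A n (fun l => lsum w l ^ 2)))).
    2:{ intros k. rewrite (ie_ext n _ (fun l => w k ^ 2 + ((2 * w k) * lsum w l + lsum w l ^ 2)))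
          by (intros; ring).
        rewrite (ie_plus n (fun _ => w k ^ 2)), (ie_plus n (fun l => _ * _)), ie_const, ie_scal.
        unfold m0. ring. }
    rewrite (pl_plus A HA), (pl_plus A HA), !(pl_scal A HA), (pl_const A HA).
    fold m0 m1 m2. rewrite S_INR.
    pose proof (mass_pow_le n) as Hm. fold m0 in Hm. pose proof mass_ge as H0. fold m0 in H0.
    fold m0 in mass_le.
    pose proof (ie_lsum_abs n) as Hs.
    assert (0 <= m2) by (apply (pl_nonneg A HA); intros; apply pow2_ge_0).
    assert (0 <= iter_expect A n (fun l => lsum w l ^ 2)).
    { replace 0 with (iter_expect A n (fun _ => 0)) by (rewrite ie_const; ring).
      apply ie_le. intros; apply pow2_ge_0. }
    assert (iter_expect A n (lsum w) * m1 <= INR n * m1 ^ 2).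
    { eapply Rle_trans; [apply Rle_abs|]. rewrite Rabs_mult.
      replace (m1 ^ 2) with (Rabs m1 * Rabs m1).
      - pose proof (Rabs_pos m1). nra.
      - rewrite <- Rabs_mult, Rabs_pos_eq; [ring|nra]. }
    assert (0 <= m1 ^ 2) by apply pow2_ge_0.
    pose proof (pos_INR n). nra.
Qed.

Lemma ie_lsum_le n : (forall k, 0 <= w k) -> iter_expect A n (lsum w) <= INR n * m1.
Proof.
  intros Hw. eapply Rle_trans; [apply Rle_abs|].
  replace m1 with (Rabs m1); [apply ie_lsum_abs|].
  apply Rabs_pos_eq, (pl_nonneg A HA), Hw.
Qed.

Variables (F F1 : R -> R) (B B1 L : R).
Hypothesis F_bound : forall y, Rabs (F y) <= B.
Hypothesis F1_bound : forall y, Rabs (F1 y) <= B1.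
Hypothesis F1_lip : forall y a, Rabs (F1 (y + a) - F1 y) <= L * Rabs a.
Hypothesis F_taylor : forall y a, Rabs (F (y + a) - F y - a * F1 y) <= L * a ^ 2.

(* Stein's identity [E (S F(S)) = n m2 E (F'(S))] up to an error, uniformly in the shift [x] so
   that the summands can be peeled off one at a time. *)
Lemma stein_iter n : forall x,
  Rabs (iter_expect A n (fun l => lsum w l * F (x + lsum w l))
        - INR n * m2 * iter_expect A n (fun l => F1 (x + lsum w l)))
  <= INR n * (B * Rabs m1 + m2 * (B1 * (1 - m0) + L * A (fun k => Rabs (w k)))
              + L * A (fun k => Rabs (w k) ^ 3)).
Proof.
  pose proof mass_ge as H0. fold m0 in H0. fold m0 in mass_le.
  assert (HB : 0 <= B) by (eapply Rle_trans; [apply Rabs_pos|apply (F_bound 0)]).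
  assert (HB1 : 0 <= B1) by (eapply Rle_trans; [apply Rabs_pos|apply (F1_bound 0)]).
  assert (HL : 0 <= L).
  { pose proof (F1_lip 0 1) as H. rewrite Rabs_R1 in H.
    pose proof (Rabs_pos (F1 (0 + 1) - F1 0)). lra. }
  assert (Hm2 : 0 <= m2) by (apply (pl_nonneg A HA); intros; apply pow2_ge_0).
  induction n as [|n IH]; intros x.
  - simpl. rewrite !Rmult_0_l, Rminus_0_r, Rabs_R0. lra.
  (* Averaging over the other coordinates preserves the bounds on [F] and [F1], so [Psi] and [Psi1]
     inherit the Lipschitz and Taylor estimates, and the first coordinate can be expanded around
     [x]. *)
  - set (Psi := fun y => iter_expect A n (fun l => F (y + lsum w l))).
    set (Psi1 := fun y => iter_expect A n (fun l => F1 (y + lsum w l))).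
    set (Q := fun y => iter_expect A n (fun l => lsum w l * F (y + lsum w l))).
    set (eps := B * Rabs m1 + m2 * (B1 * (1 - m0) + L * A (fun k => Rabs (w k)))
              + L * A (fun k => Rabs (w k) ^ 3)) in *.
    assert (HPsi : forall y, Rabs (Psi y) <= B) by (intros; apply ie_abs_bound; auto).
    assert (HPsi1 : forall y, Rabs (Psi1 y) <= B1) by (intros; apply ie_abs_bound; auto).
    assert (Hlip : forall y a, Rabs (Psi1 (y + a) - Psi1 y) <= L * Rabs a).
    { intros y a. unfold Psi1. rewrite <- ie_minus. apply ie_abs_bound.
      - intros l _. replace (y + a + lsum w l) with (y + lsum w l + a) by ring. apply F1_lip.
      - pose proof (Rabs_pos a). nra. }
    assert (Htay : forall y a, Rabs (Psi (y + a) - Psi y - a * Psi1 y) <= L * a ^ 2).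
    { intros y a. unfold Psi1, Psi. rewrite <- ie_scal, <- !ie_minus. apply ie_abs_bound.
      - intros l _. replace (y + a + lsum w l) with (y + lsum w l + a) by ring. apply F_taylor.
      - pose proof (pow2_ge_0 a). nra. }
    assert (E1 : iter_expect A (S n) (fun l => lsum w l * F (x + lsum w l))
                 = A (fun a => w a * Psi (x + w a)) + A (fun a => Q (x + w a))).
    { simpl iter_expect. rewrite <- (pl_plus A HA). apply (pl_ext A HA). intros k.
      unfold Psi, Q. rewrite <- ie_scal, <- ie_plus. apply ie_ext. intros l _.
      replace (x + (w k + lsum w l)) with (x + w k + lsum w l) by ring. ring. }
    assert (E2 : iter_expect A (S n) (fun l => F1 (x + lsum w l))
                 = A (fun a => Psi1 (x + w a))).
    { simpl iter_expect. apply (pl_ext A HA). intros k.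
      unfold Psi1. apply ie_ext. intros l _. f_equal. simpl. ring. }
    rewrite E1, E2, S_INR.
    assert (E3 : Rabs (A (fun a => Q (x + w a)) - INR n * m2 * A (fun a => Psi1 (x + w a)))
                 <= INR n * eps).
    { rewrite <- (pl_scal A HA), <- (pl_minus A HA).
      assert (0 <= INR n * eps) by (eapply Rle_trans; [apply Rabs_pos|apply (IH 0)]).
      eapply Rle_trans; [apply (pl_abs A HA _ (fun _ => INR n * eps))|].
      - intros k. apply IH.
      - rewrite (pl_const A HA). fold m0. nra. }
    assert (E4 : Rabs (A (fun a => w a * Psi (x + w a)) - m1 * Psi x - m2 * Psi1 x)
                 <= L * A (fun k => Rabs (w k) ^ 3)).
    { replace (m1 * Psi x) with (A (fun a => Psi x * w a)) by (rewrite (pl_scal A HA); unfold m1; ring).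
      replace (m2 * Psi1 x) with (A (fun a => Psi1 x * w a ^ 2))
        by (rewrite (pl_scal A HA); unfold m2; ring).
      rewrite <- !(pl_minus A HA), <- (pl_scal A HA). apply (pl_abs A HA). intros k.
      replace (w k * Psi (x + w k) - Psi x * w k - Psi1 x * w k ^ 2)
        with (w k * (Psi (x + w k) - Psi x - w k * Psi1 x)) by ring.
      rewrite Rabs_mult. specialize (Htay x (w k)). pose proof (Rabs_pos (w k)).
      replace (L * Rabs (w k) ^ 3) with (Rabs (w k) * (L * Rabs (w k) ^ 2)) by ring.
      rewrite pow2_abs. apply Rmult_le_compat_l; auto. }
    assert (E5 : Rabs (A (fun a => Psi1 (x + w a)) - m0 * Psi1 x) <= L * A (fun k => Rabs (w k))).
    { replace (m0 * Psi1 x) with (A (fun a => Psi1 x)) by (rewrite (pl_const A HA); unfold m0; ring).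
      rewrite <- (pl_minus A HA), <- (pl_scal A HA). apply (pl_abs A HA). intros k. apply Hlip. }
    set (P := A (fun a => Psi1 (x + w a))) in *.
    (* [P] averages [Psi1] at the shifted points, whereas the expansion in [E4] produced [Psi1 x];
       exchanging them costs the missing mass and one Lipschitz step. *)
    assert (E6 : Rabs (P - Psi1 x) <= B1 * (1 - m0) + L * A (fun k => Rabs (w k))).
    { replace (P - Psi1 x) with ((P - m0 * Psi1 x) - (1 - m0) * Psi1 x) by ring.
      eapply Rle_trans; [apply Rabs_triang|]. rewrite Rabs_Ropp, Rabs_mult.
      rewrite (Rabs_pos_eq (1 - m0)) by lra. specialize (HPsi1 x). nra. }
    replace (A (fun a => w a * Psi (x + w a)) + A (fun a => Q (x + w a)) - (INR n + 1) * m2 * P)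
      with ((A (fun a => w a * Psi (x + w a)) - m1 * Psi x - m2 * Psi1 x)
            + (A (fun a => Q (x + w a)) - INR n * m2 * P) + m1 * Psi x - m2 * (P - Psi1 x)) by ring.
    assert (E7 : Rabs (m1 * Psi x) <= B * Rabs m1).
    { rewrite Rabs_mult. specialize (HPsi x). pose proof (Rabs_pos m1). nra. }
    assert (E8 : Rabs (m2 * (P - Psi1 x)) <= m2 * (B1 * (1 - m0) + L * A (fun k => Rabs (w k)))).
    { rewrite Rabs_mult, (Rabs_pos_eq m2) by lra. apply Rmult_le_compat_l; auto. }
    apply Rabs_le_between in E3. apply Rabs_le_between in E4. apply Rabs_le_between in E7.
    apply Rabs_le_between in E8. apply Rabs_le. unfold eps in *. split; lra.
Qed.

End IterExpect.

Lemma lsum_ext f g l : (forall k, f k = g k) -> lsum f l = lsum g l.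
Proof. intros H. induction l; simpl; auto. rewrite H. lra. Qed.

Lemma lsum_plus f g l : lsum (fun k => f k + g k) l = lsum f l + lsum g l.
Proof. induction l; simpl; lra. Qed.

Lemma lsum_scal c f l : lsum (fun k => c * f k) l = c * lsum f l.
Proof. induction l; simpl; lra. Qed.

Lemma lsum_const c l : lsum (fun _ => c) l = c * INR (length l).
Proof. induction l as [|a l IH]; [simpl; ring|]. simpl length. rewrite S_INR. simpl. lra. Qed.

Lemma lsum_abs f g l : (forall k, Rabs (f k) <= g k) -> Rabs (lsum f l) <= lsum g l.
Proof.
  intros H. induction l as [|a l IH]; simpl; [rewrite Rabs_R0; lra|].
  eapply Rle_trans; [apply Rabs_triang|]. specialize (H a). lra.
Qed.

(** Nonnegativity is proved alongside because [A] and [A'] are comparable on nonnegative functions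
    only, and the inner expectation is such a function. The lemma yields monotonicity in the box
    size. *)
Lemma iter_expect_mono_functional A A' : positive_linear A -> positive_linear A' ->
  (forall f, (forall k, 0 <= f k) -> A f <= A' f) ->
  forall n G, (forall l, 0 <= G l) ->
  0 <= iter_expect A n G /\ iter_expect A n G <= iter_expect A' n G.
Proof.
  intros HA HA' Hle n. induction n as [|n IH]; intros G HG; simpl; [split; [auto|lra]|].
  assert (H : forall k, 0 <= iter_expect A n (fun l => G (k :: l)) /\
    iter_expect A n (fun l => G (k :: l)) <= iter_expect A' n (fun l => G (k :: l)))
    by (intros; apply IH; auto).
  split.
  - apply (pl_nonneg A HA). apply H.
  - eapply Rle_trans; [apply Hle; apply H|]. apply (pl_le A' HA'). apply H.
Qed.

(** * Taylor estimates and the normal distribution function *)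

(** [auto_derive] leaves the derivative of an abstract function as an eta-expanded [Derive]; this
    inserts its known value. *)
Ltac rewrite_derive H :=
  match type of H with is_derive ?f ?x ?l =>
    replace (Derive (fun y : R => f y) x) with l by (symmetry; exact (is_derive_unique f x l H))
  end.

Lemma is_derive_cont (f : R -> R) (x l : R) : is_derive f x l -> continuous f x.
Proof. intros H. apply (ex_derive_continuous f). exists l. exact H. Qed.

Lemma mean_value (f df : R -> R) (a b : R) :
  (forall t, Rmin a b <= t <= Rmax a b -> is_derive f t (df t)) ->
  exists c, Rmin a b <= c <= Rmax a b /\ f b - f a = df c * (b - a).
Proof.
  intros H. apply MVT_gen.
  - intros x Hx. apply H. lra.
  - intros x Hx. apply continuity_pt_filterlim, (is_derive_cont _ _ _ (H x Hx)).
Qed.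

Lemma mean_value_abs (f df : R -> R) (a b K : R) :
  (forall t, Rmin a b <= t <= Rmax a b -> is_derive f t (df t)) ->
  (forall t, Rmin a b <= t <= Rmax a b -> Rabs (df t) <= K) ->
  Rabs (f b - f a) <= K * Rabs (b - a).
Proof.
  intros H HK. destruct (mean_value f df a b H) as [c [Hc E]]. rewrite E, Rabs_mult.
  apply Rmult_le_compat_r; [apply Rabs_pos|]. apply HK, Hc.
Qed.

(** The mean value inequality is applied to [f t - t * f1 a], and once more to its derivative
    [f1 t - f1 a]. The constant is [K] rather than [K / 2]; only orders matter below. *)
Lemma taylor2_abs (f f1 f2 : R -> R) (a b K : R) :
  (forall t, Rmin a b <= t <= Rmax a b -> is_derive f t (f1 t)) ->
  (forall t, Rmin a b <= t <= Rmax a b -> is_derive f1 t (f2 t)) ->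
  (forall t, Rmin a b <= t <= Rmax a b -> Rabs (f2 t) <= K) ->
  Rabs (f b - f a - (b - a) * f1 a) <= K * (b - a) ^ 2.
Proof.
  intros H1 H2 HK.
  replace (f b - f a - (b - a) * f1 a)
    with ((fun t => f t - t * f1 a) b - (fun t => f t - t * f1 a) a) by ring.
  replace (K * (b - a) ^ 2) with (K * Rabs (b - a) * Rabs (b - a)).
  2:{ rewrite <- (pow2_abs (b - a)). ring. }
  assert (HK0 : 0 <= K).
  { eapply Rle_trans; [apply Rabs_pos|apply (HK a)]. split; [apply Rmin_l|apply Rmax_l]. }
  apply (mean_value_abs (fun t => f t - t * f1 a) (fun t => f1 t - f1 a) a b).
  - intros t Ht. auto_derive.
    + exists (f1 t). apply H1, Ht.
    + rewrite_derive (H1 t Ht). ring.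
  - intros t Ht.
    assert (Hsub : forall s, Rmin a t <= s <= Rmax a t -> Rmin a b <= s <= Rmax a b).
    { intros s. unfold Rmin, Rmax in *.
      destruct (Rle_dec a b); destruct (Rle_dec a t); intros; lra. }
    eapply Rle_trans; [apply (mean_value_abs f1 f2 a t K)|].
    + intros s Hs. apply H2, Hsub, Hs.
    + intros s Hs. apply HK, Hsub, Hs.
    + apply Rmult_le_compat_l; auto. unfold Rmin, Rmax in Ht.
      destruct (Rle_dec a b); unfold Rabs; destruct (Rcase_abs (t - a)), (Rcase_abs (b - a)); lra.
Qed.

(** The derivative of the remainder of [f] is the second-order remainder of [f1]. *)
Lemma taylor3_abs (f f1 f2 f3 : R -> R) (a b K : R) :
  (forall t, Rmin a b <= t <= Rmax a b -> is_derive f t (f1 t)) ->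
  (forall t, Rmin a b <= t <= Rmax a b -> is_derive f1 t (f2 t)) ->
  (forall t, Rmin a b <= t <= Rmax a b -> is_derive f2 t (f3 t)) ->
  (forall t, Rmin a b <= t <= Rmax a b -> Rabs (f3 t) <= K) ->
  Rabs (f b - f a - (b - a) * f1 a - (b - a) ^ 2 / 2 * f2 a) <= K * Rabs (b - a) ^ 3.
Proof.
  intros H1 H2 H3 HK.
  set (g := fun t => f t - (t - a) * f1 a - (t - a) ^ 2 / 2 * f2 a).
  replace (f b - f a - (b - a) * f1 a - (b - a) ^ 2 / 2 * f2 a) with (g b - g a)
    by (unfold g; field).
  replace (K * Rabs (b - a) ^ 3) with (K * (b - a) ^ 2 * Rabs (b - a))
    by (rewrite <- (pow2_abs (b - a)); ring).
  apply (mean_value_abs g (fun t => f1 t - f1 a - (t - a) * f2 a)).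
  - intros t Ht. pose proof (H1 t Ht) as Hd. unfold g. auto_derive.
    + eexists; exact Hd.
    + rewrite_derive Hd. field.
  - intros t Ht.
    assert (Hsub : forall s, Rmin a t <= s <= Rmax a t -> Rmin a b <= s <= Rmax a b).
    { intros s. unfold Rmin, Rmax in *.
      destruct (Rle_dec a b); destruct (Rle_dec a t); intros; lra. }
    assert (HK0 : 0 <= K) by (eapply Rle_trans; [apply Rabs_pos|apply (HK t Ht)]).
    eapply Rle_trans; [apply (taylor2_abs f1 f2 f3 a t K); auto|].
    apply Rmult_le_compat_l; auto. rewrite <- (pow2_abs (t - a)), <- (pow2_abs (b - a)).
    apply pow_incr. split; [apply Rabs_pos|]. unfold Rmin, Rmax in Ht.
    destruct (Rle_dec a b); unfold Rabs; destruct (Rcase_abs (t - a)), (Rcase_abs (b - a)); lra.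
Qed.

(** * The Gaussian integral and the tail of the normal distribution function *)

Lemma sqrt_2PI_pos : 1 < sqrt (2 * PI).
Proof.
  rewrite <- sqrt_1 at 1. apply sqrt_lt_1; pose proof PI2_1; lra.
Qed.

Lemma gauss_pos x : 0 < gauss x.
Proof.
  unfold gauss. pose proof sqrt_2PI_pos. apply Rdiv_lt_0_compat; [apply exp_pos|lra].
Qed.

Lemma gauss_le_1 x : gauss x <= 1.
Proof.
  unfold gauss. pose proof sqrt_2PI_pos. apply Rle_div_l; [lra|].
  assert (exp (- (x ^ 2) / 2) <= 1); [|lra].
  rewrite <- exp_0. apply Rnot_lt_le. intros C. apply exp_lt_inv in C. nra.
Qed.

Lemma gauss_even x : gauss (- x) = gauss x.
Proof. unfold gauss. do 3 f_equal. ring. Qed.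

Lemma is_derive_gauss (x : R) : is_derive gauss x (- x * gauss x).
Proof.
  unfold gauss. pose proof sqrt_2PI_pos. auto_derive; [lra|]. simpl. unfold Rdiv. field. lra.
Qed.

Lemma gauss_continuous x : continuous gauss x.
Proof. exact (is_derive_cont _ _ _ (is_derive_gauss x)). Qed.

Lemma ex_RInt_cont (f : R -> R) a b : (forall x, continuous f x) -> ex_RInt f a b.
Proof. intros H. apply (ex_RInt_continuous (V := R_CompleteNormedModule)). intros; apply H. Qed.

Lemma Phi_RInt x : Phi x = / 2 + RInt gauss 0 x.
Proof.
  unfold Phi. destruct (Rle_dec 0 x) as [H|H]; unfold int_gauss; rewrite <- RInt_Reals.
  - reflexivity.
  - rewrite <- (opp_RInt_swap gauss 0 x) by (apply ex_RInt_cont, gauss_continuous).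
    unfold opp; simpl. ring.
Qed.

Lemma is_derive_RInt_cont (f : R -> R) a x :
  (forall y, continuous f y) -> is_derive (fun y => RInt f a y) x (f x).
Proof.
  intros H. apply (is_derive_RInt f _ a); [|apply H].
  exists (mkposreal 1 Rlt_0_1). intros y _.
  apply (RInt_correct (V := R_CompleteNormedModule)), ex_RInt_cont, H.
Qed.

Lemma is_derive_Phi (x : R) : is_derive Phi x (gauss x).
Proof.
  apply (is_derive_ext (fun y => / 2 + RInt gauss 0 y)).
  - intros; symmetry; apply Phi_RInt.
  - replace (gauss x) with (0 + gauss x) by ring.
    apply (is_derive_plus (fun _ => / 2)); [apply (is_derive_const (V := R_NormedModule))|].
    apply is_derive_RInt_cont, gauss_continuous.
Qed.

Lemma Phi_0 : Phi 0 = / 2.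
Proof. rewrite Phi_RInt, RInt_point. unfold zero; simpl. ring. Qed.

Lemma derive_0_const (f : R -> R) : (forall x, is_derive f x 0) -> forall x y, f x = f y.
Proof.
  intros H x y. destruct (mean_value f (fun _ => 0) x y) as [c [_ E]]; [auto|lra].
Qed.

Lemma Phi_opp x : Phi (- x) = 1 - Phi x.
Proof.
  enough (E : Phi x + Phi (- x) = Phi 0 + Phi (- 0)).
  { rewrite Ropp_0, Phi_0 in E. lra. }
  apply (derive_0_const (fun x => Phi x + Phi (- x))). intros y.
  auto_derive.
  - repeat split; eexists; apply is_derive_Phi.
  - rewrite_derive (is_derive_Phi y). rewrite_derive (is_derive_Phi (- y)).
    rewrite gauss_even. ring.
Qed.

Lemma Phi_incr x y : x <= y -> 0 <= Phi y - Phi x <= y - x.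
Proof.
  intros H. destruct (mean_value Phi gauss x y) as [c [_ E]].
  - intros; apply is_derive_Phi.
  - pose proof (gauss_pos c). pose proof (gauss_le_1 c). rewrite E. split; nra.
Qed.

(* [(Phi x - 1/2)^2 + gauss_compl x] is constant: both summands have opposite derivatives after
   the substitution [t = x u] in the integral of the Gaussian. *)
Definition gauss_kernel (x u : R) : R := exp (- (x ^ 2 * (1 + u ^ 2)) / 2) / (1 + u ^ 2) / PI.
Definition gauss_compl (x : R) : R := RInt (gauss_kernel x) 0 1.

Lemma one_plus_sq_pos u : 0 < 1 + u ^ 2.
Proof. pose proof (pow2_ge_0 u). lra. Qed.

Lemma gauss_kernel_derive (x u : R) :
  is_derive (fun z => gauss_kernel z u) x (- (x * exp (- (x ^ 2 * (1 + u ^ 2)) / 2) / PI)).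
Proof.
  unfold gauss_kernel. pose proof PI_RGT_0. pose proof (one_plus_sq_pos u).
  auto_derive; [repeat split; simpl in *; lra|]. simpl in *. unfold Rdiv. field. split; lra.
Qed.

Lemma gauss_kernel_cont x u : continuous (gauss_kernel x) u.
Proof.
  apply (ex_derive_continuous (gauss_kernel x)). unfold gauss_kernel.
  pose proof PI_RGT_0. pose proof (one_plus_sq_pos u). auto_derive. lra.
Qed.

Lemma gauss_compl_derive x :
  is_derive gauss_compl x (RInt (fun u => - (x * exp (- (x ^ 2 * (1 + u ^ 2)) / 2) / PI)) 0 1).
Proof.
  pose proof PI_RGT_0.
  rewrite (RInt_ext _ (fun t => Derive (fun u => gauss_kernel u t) x)).
  2:{ intros u _. symmetry. apply is_derive_unique, gauss_kernel_derive. }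
  apply (is_derive_RInt_param gauss_kernel 0 1 x).
  - exists (mkposreal 1 Rlt_0_1). intros y _ t _. eexists. apply gauss_kernel_derive.
  - intros t _.
    apply (continuity_2d_pt_ext (fun x u => - (x * exp (- (x ^ 2 * (1 + u ^ 2)) / 2) / PI))).
    + intros y u. symmetry. apply is_derive_unique, gauss_kernel_derive.
    + apply (continuity_2d_pt_opp (fun x u => x * exp (- (x ^ 2 * (1 + u ^ 2)) / 2) / PI)).
      apply (continuity_2d_pt_mult (fun x u => x * exp (- (x ^ 2 * (1 + u ^ 2)) / 2))
               (fun _ _ => / PI)); [|apply continuity_2d_pt_const].
      apply (continuity_2d_pt_mult (fun x _ => x) (fun x u => exp (- (x ^ 2 * (1 + u ^ 2)) / 2)));
        [apply continuity_2d_pt_id1|].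
      apply (continuity_1d_2d_pt_comp exp (fun x u => - (x ^ 2 * (1 + u ^ 2)) / 2)).
      { apply derivable_continuous_pt, derivable_pt_exp. }
      apply (continuity_2d_pt_mult (fun x u => - (x ^ 2 * (1 + u ^ 2))) (fun _ _ => / 2));
        [|apply continuity_2d_pt_const].
      apply (continuity_2d_pt_opp (fun x u => x ^ 2 * (1 + u ^ 2))).
      apply (continuity_2d_pt_mult (fun x _ => x ^ 2) (fun _ u => 1 + u ^ 2)).
      * apply (continuity_1d_2d_pt_comp (fun x => x ^ 2) (fun x _ => x));
          [apply derivable_continuous_pt, derivable_pt_pow|apply continuity_2d_pt_id1].
      * apply (continuity_2d_pt_plus (fun _ _ => 1) (fun _ u => u ^ 2));
          [apply continuity_2d_pt_const|].
        apply (continuity_1d_2d_pt_comp (fun x => x ^ 2) (fun _ u => u));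
          [apply derivable_continuous_pt, derivable_pt_pow|apply continuity_2d_pt_id2].
  - exists (mkposreal 1 Rlt_0_1). intros y _. apply ex_RInt_cont, gauss_kernel_cont.
Qed.

Lemma RInt_scale_gauss x :
  RInt (fun u => - (x * exp (- (x ^ 2 * (1 + u ^ 2)) / 2) / PI)) 0 1
  = - (2 * gauss x * RInt gauss 0 x).
Proof.
  pose proof PI_RGT_0. pose proof sqrt_2PI_pos.
  replace (RInt gauss 0 x) with (RInt gauss (x * 0 + 0) (x * 1 + 0)) by (f_equal; ring).
  rewrite <- (RInt_comp_lin gauss x 0 0 1) by (apply ex_RInt_cont, gauss_continuous).
  transitivity (scal (- (2 * gauss x)) (RInt (fun y => scal x (gauss (x * y + 0))) 0 1)).
  2:{ unfold scal; simpl; unfold mult; simpl; ring. }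
  rewrite <- (RInt_scal (V := R_CompleteNormedModule) (fun y => scal x (gauss (x * y + 0)))).
  - apply RInt_ext. intros u _. unfold scal; simpl; unfold mult; simpl. unfold gauss.
    replace (- (x * (x * 1) * (1 + u * (u * 1))) / 2) with (- (x ^ 2) / 2 + - ((x * u + 0) ^ 2) / 2) by (simpl; field).
    rewrite exp_plus.
    (* The kernel carries [1 / PI], the product of two Gaussian densities only [1 / (2 * PI)]; the
       missing 2 comes from differentiating the square of [Phi x - / 2]. *)
    assert (E : sqrt (2 * PI) * sqrt (2 * PI) = 2 * PI) by (apply sqrt_sqrt; lra).
    replace (/ PI) with (2 / (sqrt (2 * PI) * sqrt (2 * PI))) by (rewrite E; field; lra).
    unfold Rdiv at 1.
    replace (/ PI) with (2 / (sqrt (2 * PI) * sqrt (2 * PI))) by (rewrite E; field; lra).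
    field. lra.
  - apply ex_RInt_cont. intros u.
    apply (ex_derive_continuous (fun y => x * gauss (x * y + 0))).
    auto_derive. eexists. apply is_derive_gauss.
Qed.

(** At 0 the kernel is [1 / (PI * (1 + u ^ 2))], with primitive [atan u / PI]; the value
    [atan 1 = PI / 4] is what makes the total Gaussian mass equal to one. *)
Lemma gauss_compl_0 : gauss_compl 0 = / 4.
Proof.
  pose proof PI_RGT_0. unfold gauss_compl.
  apply is_RInt_unique.
  replace (/ 4) with (minus (atan 1 / PI) (atan 0 / PI)).
  2:{ rewrite atan_0, atan_1. unfold minus, plus, opp; simpl. field. lra. }
  apply (is_RInt_derive (fun u => atan u / PI) (gauss_kernel 0)).
  - intros u _. pose proof (one_plus_sq_pos u).
    replace (gauss_kernel 0 u) with (/ (1 + u ^ 2) / PI).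
    + auto_derive; [auto|]. unfold Rsqr. simpl in *. field. split; lra.
    + unfold gauss_kernel. replace (- (0 ^ 2 * (1 + u ^ 2)) / 2) with 0 by field.
      rewrite exp_0. field. split; lra.
  - intros u _. apply gauss_kernel_cont.
Qed.

(** [Phi] is built by integrating from 0, so its limit 1 at infinity is the Gaussian integral and
    needs proof. It is contained here: the identity reads [Phi x * (1 - Phi x) = gauss_compl x], and
    the right-hand side vanishes at infinity. *)
Lemma Phi_compl x : (Phi x - / 2) ^ 2 + gauss_compl x = / 4.
Proof.
  transitivity ((Phi 0 - / 2) ^ 2 + gauss_compl 0).
  2:{ rewrite Phi_0, gauss_compl_0. ring. }
  apply (derive_0_const (fun x => (Phi x - / 2) ^ 2 + gauss_compl x)). intros y.
  pose proof (gauss_compl_derive y) as Hd. rewrite RInt_scale_gauss in Hd.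
  auto_derive.
  - repeat split; eexists; [apply is_derive_Phi|apply Hd].
  - rewrite_derive (is_derive_Phi y). rewrite_derive Hd.
    rewrite (Phi_RInt y). ring.
Qed.

Lemma exp_neg_le_inv y : 0 <= y -> exp (- y) <= / (1 + y).
Proof.
  intros Hy. rewrite exp_Ropp. apply Rinv_le_contravar; [lra|].
  destruct (Req_dec y 0) as [->|]; [rewrite exp_0; lra|]. apply Rlt_le, exp_ineq1. lra.
Qed.

Lemma gauss_compl_bound x : 0 < x -> 0 <= gauss_compl x <= 2 / x ^ 2.
Proof.
  intros Hx. pose proof PI_RGT_0. pose proof PI2_1. assert (0 < x ^ 2) by nra.
  assert (Hk : forall u, 0 <= gauss_kernel x u <= 2 / x ^ 2).
  { intros u. unfold gauss_kernel. pose proof (one_plus_sq_pos u). pose proof (pow2_ge_0 u).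
    assert (Hpos := exp_pos (- (x ^ 2 * (1 + u ^ 2)) / 2)).
    split.
    - apply Rlt_le. repeat apply Rdiv_lt_0_compat; lra.
    - assert (E : exp (- (x ^ 2 * (1 + u ^ 2)) / 2) <= 2 / x ^ 2).
      { replace (- (x ^ 2 * (1 + u ^ 2)) / 2) with (- (x ^ 2 * (1 + u ^ 2) / 2)) by field.
        eapply Rle_trans; [apply exp_neg_le_inv; nra|].
        replace (2 / x ^ 2) with (/ (x ^ 2 / 2)) by (field; lra).
        apply Rinv_le_contravar; nra. }
      apply Rle_div_l; [lra|]. apply Rle_div_l; [lra|].
      assert (0 < 2 / x ^ 2) by (apply Rdiv_lt_0_compat; lra).
      eapply Rle_trans; [apply E|]. rewrite Rmult_assoc.
      rewrite <- (Rmult_1_r (2 / x ^ 2)) at 1. apply Rmult_le_compat_l; nra. }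
  split.
  - unfold gauss_compl. apply RInt_ge_0; [lra|apply ex_RInt_cont, gauss_kernel_cont|].
    intros; apply Hk.
  - assert (E := abs_RInt_le_const (gauss_kernel x) 0 1 (2 / x ^ 2)).
    eapply Rle_trans; [apply Rle_abs|]. rewrite Rminus_0_r, Rmult_1_l in E. apply E.
    + lra.
    + apply ex_RInt_cont, gauss_kernel_cont.
    + intros t _. rewrite Rabs_pos_eq; apply Hk.
Qed.

(** Since [Phi x >= / 2], the factor [1 - Phi x] in [Phi_compl] is at most twice [gauss_compl x].
    This crude rate is enough to start the Mills bounds. *)
Lemma Phi_tail x : 0 < x -> 0 <= 1 - Phi x <= 4 / x ^ 2.
Proof.
  intros Hx. pose proof (gauss_compl_bound x Hx). pose proof (Phi_compl x).
  pose proof (Phi_incr 0 x (Rlt_le _ _ Hx)). rewrite Phi_0 in *.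
  split; [nra|]. assert (0 < 4 / x ^ 2) by (apply Rdiv_lt_0_compat; nra).
  replace (4 / x ^ 2) with (2 * (2 / x ^ 2)) by (field; nra). nra.
Qed.

Lemma Phi_bounds x : 0 <= Phi x <= 1.
Proof.
  assert (forall y, 0 < y -> Phi y <= 1) by (intros y Hy; pose proof (Phi_tail y Hy); lra).
  assert (Hle : forall y, Phi y <= 1).
  { intros y. pose proof (Rmax_l y 1). pose proof (Rmax_r y 1).
    pose proof (H (Rmax y 1) ltac:(lra)). pose proof (Phi_incr y (Rmax y 1) ltac:(lra)). lra. }
  split; auto. pose proof (Hle (- x)). rewrite Phi_opp in *. lra.
Qed.

(** * Stein's equation *)

(** A decreasing function whose limit at infinity is at least zero is nonnegative; the explicit
    lower bound [- C / y] stands in for the limit. *)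
Lemma decr_vanishing_nonneg (f df : R -> R) (x C : R) :
  0 < x -> 0 <= C ->
  (forall t, x <= t -> is_derive f t (df t)) ->
  (forall t, x <= t -> df t <= 0) ->
  (forall y, x <= y -> 1 <= y -> - C / y <= f y) ->
  0 <= f x.
Proof.
  intros Hx HC Hd Hdf Hb. apply Rnot_lt_le. intros Hneg.
  set (d := - f x). assert (Hd0 : 0 < d) by (unfold d; lra).
  (* Far enough out that [C / y < d], while monotonicity keeps [f y <= - d]. *)
  set (y := x + 1 + C / d).
  assert (HCd : 0 <= C / d) by (apply Rdiv_le_0_compat; lra).
  assert (Hxy : x <= y) by (unfold y; lra).
  destruct (mean_value f df x y) as [c [Hc E]].
  { intros t Ht. apply Hd. rewrite Rmin_left in Ht by lra. lra. }
  rewrite Rmin_left in Hc by lra.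
  assert (H1 : df c * (y - x) <= 0) by (pose proof (Hdf c (proj1 Hc)); nra).
  assert (H2 : - C / y <= f y) by (apply Hb; unfold y; lra).
  assert (H3 : C / y < d).
  { apply Rlt_div_l; [unfold y; lra|].
    replace C with (d * (C / d)) at 1 by (field; lra). unfold y. nra. }
  unfold Rdiv in *. unfold d in *. lra.
Qed.

Lemma mills_upper x : 0 < x -> 1 - Phi x <= gauss x / x.
Proof.
  intros Hx. enough (0 <= gauss x / x - (1 - Phi x)) by lra.
  apply (decr_vanishing_nonneg (fun x => gauss x / x - (1 - Phi x))
           (fun x => - (gauss x / x ^ 2)) x 4); auto; try lra.
  - intros t Ht. auto_derive.
    + repeat split; try lra; eexists; [apply is_derive_gauss|apply is_derive_Phi].
    + rewrite_derive (is_derive_gauss t). rewrite_derive (is_derive_Phi t). field. lra.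
  - intros t Ht. assert (0 < gauss t / t ^ 2); [|lra].
    apply Rdiv_lt_0_compat; [apply gauss_pos|nra].
  - intros y Hy1 Hy2. pose proof (Phi_tail y ltac:(lra)).
    assert (0 < gauss y / y) by (apply Rdiv_lt_0_compat; [apply gauss_pos|lra]).
    assert (4 / y ^ 2 <= 4 / y).
    { apply Rmult_le_compat_l; [lra|]. apply Rinv_le_contravar; nra. }
    unfold Rdiv in *. lra.
Qed.

(** The difference of the two sides decreases to zero. The exact form matters: for the Mills ratio
    [M] it says [M * (1 + x ^ 2) - x >= 0], and this is the combination met in the second derivative
    of the Stein solution. *)
Lemma mills_lower x : 0 < x -> gauss x * x / (1 + x ^ 2) <= 1 - Phi x.
Proof.
  intros Hx. enough (0 <= (1 - Phi x) - gauss x * x / (1 + x ^ 2)) by lra.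
  apply (decr_vanishing_nonneg (fun x => (1 - Phi x) - gauss x * x / (1 + x ^ 2))
           (fun x => - (2 * gauss x / (1 + x ^ 2) ^ 2)) x 1); auto; try lra.
  - intros t Ht. pose proof (one_plus_sq_pos t). auto_derive.
    + simpl in *. repeat split; try lra; eexists; [apply is_derive_Phi|apply is_derive_gauss].
    + rewrite_derive (is_derive_gauss t). rewrite_derive (is_derive_Phi t). simpl in *. field. lra.
  - intros t Ht. assert (0 < 2 * gauss t / (1 + t ^ 2) ^ 2); [|lra].
    apply Rdiv_lt_0_compat; [pose proof (gauss_pos t); lra|]. apply pow_lt, one_plus_sq_pos.
  - intros y Hy1 Hy2. pose proof (Phi_tail y ltac:(lra)).
    assert (gauss y * y / (1 + y ^ 2) <= 1 / y).
    { apply Rle_div_l; [apply one_plus_sq_pos|].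
      replace (1 / y * (1 + y ^ 2)) with (/ y + y) by (field; lra).
      assert (0 < / y) by (apply Rinv_0_lt_compat; lra).
      pose proof (gauss_le_1 y). pose proof (gauss_pos y). nra. }
    unfold Rdiv in *. lra.
Qed.

(** Squaring the positive part makes it continuously differentiable, which is regularity enough: the
    second derivative of the Stein solution involves only the first derivative of the test
    function. *)
Definition sqpos (u : R) : R := (Rmax u 0) ^ 2.

Lemma is_derive_sqpos (u : R) : is_derive sqpos u (2 * Rmax u 0).
Proof.
  apply is_derive_Reals. intros eps Heps. exists (mkposreal eps Heps). intros h Hh Hlt.
  simpl in Hlt.
  replace ((sqpos (u + h) - sqpos u) / h - 2 * Rmax u 0)
    with ((sqpos (u + h) - sqpos u - 2 * Rmax u 0 * h) / h) by (field; auto).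
  unfold Rdiv. rewrite Rabs_mult, Rabs_inv. apply Rlt_div_l; [apply Rabs_pos_lt; auto|].
  (* The error of the linear approximation is at most [h ^ 2] whatever the signs of [u] and [u + h],
     so [eps] itself serves as radius. *)
  apply Rle_lt_trans with (h ^ 2).
  - unfold sqpos, Rmax. destruct (Rle_dec u 0), (Rle_dec (u + h) 0); apply Rabs_le; split; nra.
  - rewrite <- pow2_abs. pose proof (Rabs_pos_lt h Hh). nra.
Qed.

Lemma Rmax_0_cont (u : R) : continuous (fun x => Rmax x 0) u.
Proof.
  apply (continuous_ext (fun x => (x + Rabs x) / 2)).
  - intros x. unfold Rmax, Rabs. destruct (Rle_dec x 0), (Rcase_abs x); lra.
  - unfold Rdiv. apply (continuous_mult (K := R_AbsRing)); [|apply continuous_const].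
    apply (continuous_plus (V := R_NormedModule)); [apply continuous_id|].
    apply continuous_Rabs.
Qed.

Definition smooth_step (a b t : R) : R := sqpos (b - t) / (sqpos (b - t) + sqpos (t - a)).
Definition smooth_step' (a b t : R) : R :=
  2 * (- Rmax (b - t) 0 * sqpos (t - a) - Rmax (t - a) 0 * sqpos (b - t))
  / (sqpos (b - t) + sqpos (t - a)) ^ 2.

Lemma sqpos_nonneg u : 0 <= sqpos u.
Proof. apply pow2_ge_0. Qed.

Lemma sqpos_eq0 u : u <= 0 -> sqpos u = 0.
Proof. intros H. unfold sqpos. rewrite Rmax_right by lra. ring. Qed.

Lemma sqpos_pos u : 0 < u -> 0 < sqpos u.
Proof. intros H. unfold sqpos. rewrite Rmax_left by lra. nra. Qed.

Section Step.
Variables a b : R.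
Hypothesis Hab : a < b.

Lemma step_denom_pos t : 0 < sqpos (b - t) + sqpos (t - a).
Proof.
  pose proof (sqpos_nonneg (b - t)). pose proof (sqpos_nonneg (t - a)).
  destruct (Rlt_dec t b).
  - pose proof (sqpos_pos (b - t) ltac:(lra)). lra.
  - pose proof (sqpos_pos (t - a) ltac:(lra)). lra.
Qed.

Lemma smooth_step_bounds t : 0 <= smooth_step a b t <= 1.
Proof.
  pose proof (step_denom_pos t). pose proof (sqpos_nonneg (b - t)).
  pose proof (sqpos_nonneg (t - a)). unfold smooth_step. split.
  - apply Rdiv_le_0_compat; lra.
  - apply Rle_div_l; lra.
Qed.

Lemma smooth_step_left t : t <= a -> smooth_step a b t = 1.
Proof.
  intros H. unfold smooth_step. rewrite (sqpos_eq0 (t - a)) by lra.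
  pose proof (sqpos_pos (b - t) ltac:(lra)). field. lra.
Qed.

Lemma smooth_step_right t : b <= t -> smooth_step a b t = 0.
Proof. intros H. unfold smooth_step. rewrite (sqpos_eq0 (b - t)) by lra. unfold Rdiv. ring. Qed.

Lemma smooth_step'_out t : t <= a \/ b <= t -> smooth_step' a b t = 0.
Proof.
  intros [H|H]; unfold smooth_step'.
  - rewrite (sqpos_eq0 (t - a)), (Rmax_right (t - a)) by lra. unfold Rdiv. ring.
  - rewrite (sqpos_eq0 (b - t)), (Rmax_right (b - t)) by lra. unfold Rdiv. ring.
Qed.

Lemma is_derive_smooth_step (t : R) : is_derive (smooth_step a b) t (smooth_step' a b t).
Proof.
  unfold smooth_step. pose proof (step_denom_pos t).
  pose proof (is_derive_sqpos (b - t)) as H1. pose proof (is_derive_sqpos (t - a)) as H2.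
  auto_derive.
  - repeat split; try (eexists; eassumption). apply Rgt_not_eq; exact H.
  - unfold smooth_step'. unfold Rminus in *. rewrite_derive H1. rewrite_derive H2. field. lra.
Qed.

Lemma smooth_step_cont (t : R) : continuous (smooth_step a b) t.
Proof. exact (is_derive_cont _ _ _ (is_derive_smooth_step t)). Qed.

Lemma smooth_step'_cont (t : R) : continuous (smooth_step' a b) t.
Proof.
  assert (Hb : forall t : R, continuous (fun t => b - t) t)
    by (intros; apply (ex_derive_continuous (fun t => b - t)); auto_derive; auto).
  assert (Ha : forall t : R, continuous (fun t => t - a) t)
    by (intros; apply (ex_derive_continuous (fun t => t - a)); auto_derive; auto).
  assert (Qb : continuous (fun t => sqpos (b - t)) t).
  { apply (continuous_comp (fun t => b - t)); auto. exact (is_derive_cont _ _ _ (is_derive_sqpos _)). }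
  assert (Qa : continuous (fun t => sqpos (t - a)) t).
  { apply (continuous_comp (fun t => t - a)); auto. exact (is_derive_cont _ _ _ (is_derive_sqpos _)). }
  assert (Mb : continuous (fun t => Rmax (b - t) 0) t).
  { apply (continuous_comp (fun t => b - t) (fun u => Rmax u 0)); auto. apply Rmax_0_cont. }
  assert (Ma : continuous (fun t => Rmax (t - a) 0) t).
  { apply (continuous_comp (fun t => t - a) (fun u => Rmax u 0)); auto. apply Rmax_0_cont. }
  unfold smooth_step', Rdiv.
  apply (continuous_mult (K := R_AbsRing)).
  - apply (continuous_mult (K := R_AbsRing)); [apply continuous_const|].
    apply (continuous_minus (V := R_NormedModule)); apply (continuous_mult (K := R_AbsRing)); auto.
    apply (continuous_opp (V := R_NormedModule)); auto.
  - apply (continuous_comp (fun t => sqpos (b - t) + sqpos (t - a)) (fun y => / (y ^ 2))).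
    + apply (continuous_plus (V := R_NormedModule)); auto.
    + apply (ex_derive_continuous (fun y => / (y ^ 2))). auto_derive.
      pose proof (step_denom_pos t). nra.
Qed.

(** The integral of the step against [gauss] from minus infinity: left of [a] the step is 1, so that
    part is [Phi a] and no improper integral occurs. The step vanishes beyond [b], so [step_mean] is
    the full Gaussian mean. *)
Definition step_prim (x : R) : R := Phi a + RInt (fun t => smooth_step a b t * gauss t) a x.
Definition step_mean : R := step_prim b.

Lemma step_gauss_cont (t : R) : continuous (fun t => smooth_step a b t * gauss t) t.
Proof.
  apply (continuous_mult (K := R_AbsRing)); [apply smooth_step_cont|apply gauss_continuous].
Qed.

Lemma RInt_gauss x y : RInt gauss x y = Phi y - Phi x.
Proof.
  apply is_RInt_unique. apply (is_RInt_derive Phi gauss).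
  - intros; apply is_derive_Phi.
  - intros; apply gauss_continuous.
Qed.

Lemma is_derive_step_prim (x : R) : is_derive step_prim x (smooth_step a b x * gauss x).
Proof.
  unfold step_prim. replace (smooth_step a b x * gauss x) with (0 + smooth_step a b x * gauss x) by ring.
  apply (is_derive_plus (fun _ => Phi a)); [apply (is_derive_const (V := R_NormedModule))|].
  apply (is_derive_RInt_cont (fun t => smooth_step a b t * gauss t)), step_gauss_cont.
Qed.

Lemma step_prim_left x : x <= a -> step_prim x = Phi x.
Proof.
  intros H. unfold step_prim. rewrite (RInt_ext _ gauss).
  - rewrite RInt_gauss. ring.
  - intros t Ht. rewrite Rmax_left in Ht by lra. rewrite smooth_step_left by lra. apply Rmult_1_l.
Qed.

Lemma step_prim_right x : b <= x -> step_prim x = step_mean.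
Proof.
  intros H. unfold step_mean, step_prim.
  rewrite <- (RInt_Chasles (V := R_CompleteNormedModule) _ a b x)
    by apply ex_RInt_cont, step_gauss_cont.
  rewrite (RInt_ext _ (fun _ => 0) b x).
  - rewrite RInt_const. unfold plus, scal; simpl; unfold mult; simpl. ring.
  - intros t Ht. rewrite Rmin_left in Ht by lra. rewrite smooth_step_right by lra. apply Rmult_0_l.
Qed.

Lemma step_mean_bounds : Phi a <= step_mean <= Phi b.
Proof.
  unfold step_mean, step_prim.
  assert (Hi : RInt (fun t => smooth_step a b t * gauss t) a b <= Phi b - Phi a).
  { rewrite <- RInt_gauss. apply RInt_le; [lra|apply ex_RInt_cont, step_gauss_cont|
      apply ex_RInt_cont, gauss_continuous|].
    intros x _. pose proof (smooth_step_bounds x). pose proof (gauss_pos x). nra. }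
  assert (0 <= RInt (fun t => smooth_step a b t * gauss t) a b).
  { apply RInt_ge_0; [lra|apply ex_RInt_cont, step_gauss_cont|].
    intros x _. pose proof (smooth_step_bounds x). pose proof (gauss_pos x). nra. }
  lra.
Qed.

(** The classical solution: [exp (x ^ 2 / 2)] times the integral up to [x] of the centred step
    against [exp (- t ^ 2 / 2)]. The next two functions are its derivatives, read off from the Stein
    equation itself. *)
Definition stein_sol (x : R) : R := (step_prim x - step_mean * Phi x) / gauss x.
Definition stein_sol1 (x : R) : R := x * stein_sol x + smooth_step a b x - step_mean.
Definition stein_sol2 (x : R) : R := stein_sol x + x * stein_sol1 x + smooth_step' a b x.

Lemma is_derive_stein_sol (x : R) : is_derive stein_sol x (stein_sol1 x).
Proof.
  unfold stein_sol. pose proof (gauss_pos x).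
  auto_derive.
  - repeat split.
    + exists (smooth_step a b x * gauss x). apply is_derive_step_prim.
    + exists (gauss x). apply is_derive_Phi.
    + exists (- x * gauss x). apply is_derive_gauss.
    + lra.
  - rewrite_derive (is_derive_Phi x). rewrite_derive (is_derive_gauss x).
    rewrite_derive (is_derive_step_prim x). unfold stein_sol1, stein_sol. field. lra.
Qed.

Lemma is_derive_stein_sol1 (x : R) : is_derive stein_sol1 x (stein_sol2 x).
Proof.
  unfold stein_sol1. auto_derive.
  - repeat split.
    + exists (stein_sol1 x). apply is_derive_stein_sol.
    + exists (smooth_step' a b x). apply is_derive_smooth_step.
  - rewrite_derive (is_derive_stein_sol x).
    pose proof (is_derive_smooth_step x) as H.
    replace (Derive (fun y => smooth_step a b y) x) with (smooth_step' a b x)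
      by (symmetry; exact (is_derive_unique _ _ _ H)).
    unfold stein_sol2. ring.
Qed.

Lemma stein_sol2_cont (x : R) : continuous stein_sol2 x.
Proof.
  unfold stein_sol2.
  apply (continuous_plus (V := R_NormedModule)); [|apply smooth_step'_cont].
  apply (continuous_plus (V := R_NormedModule)).
  - exact (is_derive_cont _ _ _ (is_derive_stein_sol x)).
  - apply (continuous_mult (K := R_AbsRing)); [apply continuous_id|].
    exact (is_derive_cont _ _ _ (is_derive_stein_sol1 x)).
Qed.

(* Outside a compact set the solution is a multiple of the Mills ratio at [y = |x|]. *)
Lemma mills_stein_bounds y c F : 1 <= y -> 0 <= c <= 1 -> F = c * ((1 - Phi y) / gauss y) ->
  Rabs F <= 1 /\ Rabs (y * F - c) <= 1 /\ Rabs (F + y * (y * F - c)) <= 1.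
Proof.
  intros Hy Hc ->. set (M := (1 - Phi y) / gauss y).
  pose proof (gauss_pos y) as Hg.
  assert (HU : M * y <= 1).
  { unfold M. pose proof (mills_upper y ltac:(lra)) as H.
    apply Rle_div_r in H; [|lra].
    replace ((1 - Phi y) / gauss y * y) with ((1 - Phi y) * y / gauss y) by (field; lra).
    apply Rle_div_l; lra. }
  assert (HL : y <= M * (1 + y ^ 2)).
  { unfold M. pose proof (mills_lower y ltac:(lra)) as H.
    apply Rle_div_l in H; [|apply one_plus_sq_pos].
    replace ((1 - Phi y) / gauss y * (1 + y ^ 2)) with ((1 - Phi y) * (1 + y ^ 2) / gauss y)
      by (field; lra).
    apply Rle_div_r; lra. }
  assert (0 <= M).
  { apply Rdiv_le_0_compat; auto. pose proof (Phi_bounds y). lra. }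
  assert (M <= 1) by nra.
  repeat split; apply Rabs_le; split; nra.
Qed.

(** Compactness covers [[-K, K]], the Mills ratio the rest. The bound is not explicit in [a] and
    [b]; this is harmless, as both are fixed before [T] grows. *)
Lemma stein_sol_bounded : exists B, forall x,
  Rabs (stein_sol x) <= B /\ Rabs (stein_sol1 x) <= B /\ Rabs (stein_sol2 x) <= B.
Proof.
  set (K := Rmax 1 (Rmax (Rabs a) (Rabs b))).
  assert (HK : 1 <= K /\ Rabs a <= K /\ Rabs b <= K).
  { unfold K. pose proof (Rmax_l 1 (Rmax (Rabs a) (Rabs b))).
    pose proof (Rmax_r 1 (Rmax (Rabs a) (Rabs b))).
    pose proof (Rmax_l (Rabs a) (Rabs b)). pose proof (Rmax_r (Rabs a) (Rabs b)). lra. }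
  destruct HK as [HK1 [HKa HKb]]. apply Rabs_le_between in HKa. apply Rabs_le_between in HKb.
  pose proof (Phi_bounds a). pose proof (Phi_bounds b). pose proof step_mean_bounds.
  destruct (bounded_continuity stein_sol (- K) K) as [B0 HB0].
  { intros x _. exact (is_derive_cont _ _ _ (is_derive_stein_sol x)). }
  destruct (bounded_continuity stein_sol1 (- K) K) as [B1 HB1].
  { intros x _. exact (is_derive_cont _ _ _ (is_derive_stein_sol1 x)). }
  destruct (bounded_continuity stein_sol2 (- K) K) as [B2 HB2].
  { intros x _. apply stein_sol2_cont. }
  exists (Rmax 1 (Rmax B0 (Rmax B1 B2))). intros x.
  set (B := Rmax 1 (Rmax B0 (Rmax B1 B2))).
  assert (HB : 1 <= B /\ B0 <= B /\ B1 <= B /\ B2 <= B).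
  { unfold B. pose proof (Rmax_l 1 (Rmax B0 (Rmax B1 B2))).
    pose proof (Rmax_r 1 (Rmax B0 (Rmax B1 B2))).
    pose proof (Rmax_l B0 (Rmax B1 B2)). pose proof (Rmax_r B0 (Rmax B1 B2)).
    pose proof (Rmax_l B1 B2). pose proof (Rmax_r B1 B2). lra. }
  destruct (Rle_dec K x) as [Hx|Hx]; [|destruct (Rle_dec x (- K)) as [Hx'|Hx']].
  (* Right of [b] the numerator of the solution is [c * (1 - Phi x)] with [c = step_mean]. *)
  - destruct (mills_stein_bounds x step_mean (stein_sol x)) as [E0 [E1 E2]]; try lra.
    { unfold stein_sol. rewrite step_prim_right by lra. field. apply Rgt_not_eq, gauss_pos. }
    unfold stein_sol2, stein_sol1.
    rewrite smooth_step_right, smooth_step'_out by lra. rewrite !Rplus_0_r. lra.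
  (* Left of [a] the numerator is [(1 - c) * Phi x]: the same shape at [- x], with [1 - c] in place
     of [c]. *)
  - destruct (mills_stein_bounds (- x) (1 - step_mean) (stein_sol x)) as [E0 [E1 E2]]; try lra.
    { unfold stein_sol. rewrite step_prim_left by lra. rewrite Phi_opp, gauss_even. field.
      apply Rgt_not_eq, gauss_pos. }
    unfold stein_sol2, stein_sol1.
    rewrite smooth_step_left, smooth_step'_out by lra.
    rewrite <- Rabs_Ropp in E1.
    replace (- (- x * stein_sol x - (1 - step_mean))) with (x * stein_sol x + 1 - step_mean) in E1 by ring.
    replace (stein_sol x + - x * (- x * stein_sol x - (1 - step_mean)))
      with (stein_sol x + x * (x * stein_sol x + 1 - step_mean) + 0) in E2 by ring.
    lra.
  - specialize (HB0 x ltac:(lra)). specialize (HB1 x ltac:(lra)). specialize (HB2 x ltac:(lra)).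
    unfold norm in *; simpl in *. unfold abs in *; simpl in *. lra.
Qed.

End Step.

Lemma stein_equation a b : a < b -> exists (c B : R) (F F1 g : R -> R),
  Phi a <= c <= Phi b /\ 0 <= B /\
  (forall t, 0 <= g t <= 1) /\ (forall t, t <= a -> g t = 1) /\ (forall t, b <= t -> g t = 0) /\
  (forall t, F1 t - t * F t = g t - c) /\
  (forall t, Rabs (F t) <= B) /\ (forall t, Rabs (F1 t) <= B) /\
  (forall y h, Rabs (F1 (y + h) - F1 y) <= B * Rabs h) /\
  (forall y h, Rabs (F (y + h) - F y - h * F1 y) <= B * h ^ 2).
Proof.
  intros Hab. destruct (stein_sol_bounded a b Hab) as [B HB].
  exists (step_mean a b), B, (stein_sol a b), (stein_sol1 a b), (smooth_step a b).
  repeat split.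
  - apply step_mean_bounds; auto.
  - apply step_mean_bounds; auto.
  - eapply Rle_trans; [apply Rabs_pos|apply (HB 0)].
  - apply smooth_step_bounds; auto.
  - apply smooth_step_bounds; auto.
  - apply smooth_step_left; auto.
  - apply smooth_step_right; auto.
  - intros t. unfold stein_sol1. ring.
  - apply HB.
  - apply HB.
  - intros y h. replace (Rabs h) with (Rabs ((y + h) - y)) by (f_equal; ring).
    apply (mean_value_abs _ (stein_sol2 a b)).
    + intros; apply is_derive_stein_sol1; auto.
    + intros; apply HB.
  - intros y h. pose proof (taylor2_abs (stein_sol a b) (stein_sol1 a b) (stein_sol2 a b) y (y + h) B) as H.
    replace (y + h - y) with h in H by ring. apply H.
    + intros; apply is_derive_stein_sol; auto.
    + intros; apply is_derive_stein_sol1; auto.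
    + intros; apply HB.
Qed.

(** * Bessel functions and the score *)

Lemma lim_seq_eq u l : Un_cv u l -> lim_seq u = l.
Proof.
  intros H. apply (UL_sequence u); auto. unfold lim_seq.
  apply (epsilon_spec (inhabits 0) (fun l => Un_cv u l)). exists l. exact H.
Qed.

(** [I_nu(x)] is [(x / 2) ^ nu] times the series with these coefficients at [z = x ^ 2 / 4]. Once
    the power is pulled out, differentiation in [z] is the shift from [nu] to [nu + 1]. *)
Definition bessel_coef (nu m : nat) : R := / (INR (fact m) * INR (fact (nu + m))).
Definition bessel_series (nu : nat) (z : R) : R := PSeries (bessel_coef nu) z.

Lemma INR_fact_pos n : 0 < INR (fact n).
Proof. apply lt_0_INR, lt_O_fact. Qed.

Lemma INR_fact_S n : INR (fact (S n)) = (INR n + 1) * INR (fact n).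
Proof. rewrite fact_simpl, mult_INR, S_INR. ring. Qed.

Lemma bessel_coef_pos nu m : 0 < bessel_coef nu m.
Proof. apply Rinv_0_lt_compat, Rmult_lt_0_compat; apply INR_fact_pos. Qed.

Lemma bessel_coef_S_l nu m : bessel_coef nu m = (INR nu + INR m + 1) * bessel_coef (S nu) m.
Proof.
  unfold bessel_coef. replace (S nu + m)%nat with (S (nu + m)) by lia.
  rewrite INR_fact_S, plus_INR.
  pose proof (INR_fact_pos m). pose proof (INR_fact_pos (nu + m)).
  pose proof (pos_INR nu). pose proof (pos_INR m). field. lra.
Qed.

Lemma bessel_coef_S_r nu m : bessel_coef (S nu) m = (INR m + 1) * bessel_coef nu (S m).
Proof.
  unfold bessel_coef. replace (S nu + m)%nat with (nu + S m)%nat by lia.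
  rewrite (INR_fact_S m).
  pose proof (INR_fact_pos m). pose proof (INR_fact_pos (nu + S m)).
  pose proof (pos_INR m). field. lra.
Qed.

Lemma CV_radius_bessel nu : CV_radius (bessel_coef nu) = p_infty.
Proof.
  apply CV_radius_infinite_DAlembert.
  - intros n. apply Rgt_not_eq, bessel_coef_pos.
  - apply (is_lim_seq_le_le (fun _ => 0) _ (fun n => / (INR n + 1))).
    + intros n. pose proof (bessel_coef_pos nu n). pose proof (bessel_coef_pos nu (S n)).
      split; [apply Rabs_pos|]. rewrite Rabs_pos_eq by (apply Rlt_le, Rdiv_lt_0_compat; lra).
      pose proof (bessel_coef_S_r nu n) as H1. pose proof (bessel_coef_S_l nu n) as H2.
      pose proof (pos_INR n). pose proof (pos_INR nu).
      apply Rle_div_l; [lra|]. rewrite H2, H1.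
      replace (/ (INR n + 1) * ((INR nu + INR n + 1) * ((INR n + 1) * bessel_coef nu (S n))))
        with ((INR nu + INR n + 1) * bessel_coef nu (S n)) by (field; lra).
      nra.
    + apply is_lim_seq_const.
    + apply (is_lim_seq_ext (fun n => / INR (S n))); [intros; rewrite S_INR; auto|].
      apply (is_lim_seq_incr_1 (fun n => / INR n)).
      apply (is_lim_seq_inv _ p_infty); [apply is_lim_seq_INR|discriminate].
Qed.

Lemma ex_pseries_bessel nu z : ex_pseries (bessel_coef nu) z.
Proof. apply CV_radius_inside. rewrite CV_radius_bessel. exact I. Qed.

Lemma ex_series_bessel nu z : ex_series (fun m => bessel_coef nu m * z ^ m).
Proof.
  destruct (ex_pseries_bessel nu z) as [l H]. exists l. apply (is_pseries_R (bessel_coef nu) z l), H.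
Qed.

Lemma is_derive_bessel_series nu (z : R) :
  is_derive (bessel_series nu) z (bessel_series (S nu) z).
Proof.
  unfold bessel_series.
  rewrite (PSeries_ext (bessel_coef (S nu)) (PS_derive (bessel_coef nu))).
  - apply is_derive_PSeries. rewrite CV_radius_bessel. exact I.
  - intros n. unfold PS_derive. rewrite bessel_coef_S_r, S_INR. reflexivity.
Qed.

(** Coefficientwise, the factor [nu + m + 1] of [bessel_coef_S_l] splits into [nu + 1] and [m]; by
    [bessel_coef_S_r] the second part is a shifted series. *)
Lemma bessel_series_rec nu z :
  bessel_series nu z = (INR nu + 1) * bessel_series (S nu) z + z * bessel_series (S (S nu)) z.
Proof.
  unfold bessel_series.
  rewrite <- (PSeries_incr_1 (bessel_coef (S (S nu)))), <- (PSeries_scal (INR nu + 1)), <- PSeries_plus.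
  - apply PSeries_ext. intros n. unfold PS_plus, PS_scal, PS_incr_1, plus, scal; simpl.
    unfold mult; simpl. rewrite bessel_coef_S_l. destruct n as [|n].
    + unfold zero; simpl. ring.
    + rewrite (bessel_coef_S_r (S nu) n), S_INR. ring.
  - apply ex_pseries_scal; [apply Rmult_comm|apply ex_pseries_bessel].
  - apply (ex_pseries_incr_1 (K := R_AbsRing) (V := R_NormedModule)), ex_pseries_bessel.
Qed.

Lemma PSeries_bessel nu z : bessel_series nu z = Series (fun m => bessel_coef nu m * z ^ m).
Proof. reflexivity. Qed.

Lemma bessel_series_le nu z : 0 <= z ->
  (INR nu + 1) * bessel_series (S nu) z <= bessel_series nu z.
Proof.
  intros Hz. rewrite !PSeries_bessel, <- Series_scal_l. apply Series_le; [|apply ex_series_bessel].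
  intros n. pose proof (bessel_coef_pos (S nu) n). pose proof (pow_le z n Hz).
  pose proof (pos_INR n). pose proof (pos_INR nu).
  rewrite (bessel_coef_S_l nu n). split; [|rewrite <- Rmult_assoc; apply Rmult_le_compat_r; nra].
  repeat apply Rmult_le_pos; lra.
Qed.

Lemma bessel_series_lower nu z : 0 <= z -> / INR (fact nu) <= bessel_series nu z.
Proof.
  intros Hz. rewrite PSeries_bessel.
  assert (H : is_lim_seq (sum_n (fun m => bessel_coef nu m * z ^ m))
     (Series (fun m => bessel_coef nu m * z ^ m))).
  { apply (Series_correct _ (ex_series_bessel nu z)). }
  apply (is_lim_seq_le (fun _ => / INR (fact nu)) _ (/ INR (fact nu))) with (2 := is_lim_seq_const _) (3 := H).
  intros n. induction n as [|n IH].
  - rewrite sum_O. unfold bessel_coef. simpl. rewrite Nat.add_0_r.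
    apply Req_le. field. apply Rgt_not_eq, INR_fact_pos.
  - rewrite sum_Sn. unfold plus; simpl. pose proof (bessel_coef_pos nu (S n)).
    pose proof (pow_le z (S n) Hz). simpl in *. nra.
Qed.

Lemma bessel_series_pos nu z : 0 <= z -> 0 < bessel_series nu z.
Proof.
  intros Hz. eapply Rlt_le_trans; [|apply bessel_series_lower; auto].
  apply Rinv_0_lt_compat, INR_fact_pos.
Qed.

Lemma Series_exp y : Series (fun m => / INR (fact m) * y ^ m) = exp y
  /\ ex_series (fun m => / INR (fact m) * y ^ m).
Proof.
  assert (H : is_series (fun m => / INR (fact m) * y ^ m) (exp y))
    by apply (is_pseries_R (fun m => / INR (fact m)) y (exp y)), is_exp_Reals.
  split; [apply is_series_unique, H|eexists; exact H].
Qed.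

Lemma fact_plus_ge nu m : INR (fact nu) <= INR (fact (nu + m)).
Proof. apply le_INR, fact_le. lia. Qed.

Lemma bessel_series_upper nu z : 0 <= z -> bessel_series nu z <= exp z / INR (fact nu).
Proof.
  intros Hz. destruct (Series_exp z) as [E Hex]. pose proof (INR_fact_pos nu).
  unfold Rdiv. rewrite <- E, PSeries_bessel, Rmult_comm, <- Series_scal_l.
  apply Series_le; [|apply (ex_series_scal (K := R_AbsRing) (V := R_NormedModule) (/ INR (fact nu))), Hex].
  intros n. pose proof (pow_le z n Hz). pose proof (bessel_coef_pos nu n). split; [nra|].
  rewrite <- Rmult_assoc. apply Rmult_le_compat_r; auto. unfold bessel_coef.
  rewrite Rinv_mult, Rmult_comm. apply Rmult_le_compat_r.
  - apply Rlt_le, Rinv_0_lt_compat, INR_fact_pos.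
  - apply Rinv_le_contravar; [auto|apply fact_plus_ge].
Qed.

Lemma besselI_series nu x : besselI nu x = (x / 2) ^ nu * bessel_series nu (x ^ 2 / 4).
Proof.
  unfold besselI. apply lim_seq_eq. apply is_lim_seq_Reals.
  pose proof (Series_correct _ (ex_series_bessel nu (x ^ 2 / 4))) as H.
  change (is_lim_seq (sum_n (fun m => bessel_coef nu m * (x ^ 2 / 4) ^ m))
    (Series (fun m => bessel_coef nu m * (x ^ 2 / 4) ^ m))) in H.
  apply (is_lim_seq_scal_l _ ((x / 2) ^ nu)) in H. simpl Rbar_mult in H.
  eapply is_lim_seq_ext; [|exact H].
  intros n. cbv beta. rewrite (sum_n_Reals (fun m => bessel_coef nu m * (x ^ 2 / 4) ^ m) n), scal_sum.
  apply sum_eq. intros i _. unfold bessel_coef. rewrite pow_add, pow_mult.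
  replace ((x / 2) ^ 2) with (x ^ 2 / 4) by field.
  pose proof (INR_fact_pos i). pose proof (INR_fact_pos (nu + i)). field. lra.
Qed.

(** Order zero is separate because the symmetric formula would call for order -1, where the Bessel
    function equals [I_1]. *)
Lemma is_derive_besselI_0 (x : R) : is_derive (besselI 0) x (besselI 1 x).
Proof.
  apply (is_derive_ext (fun x => bessel_series 0 (x ^ 2 / 4))).
  { intros y. rewrite besselI_series. simpl. ring. }
  rewrite besselI_series. pose proof (is_derive_bessel_series 0 (x ^ 2 / 4)) as H.
  replace ((x / 2) ^ 1 * bessel_series 1 (x ^ 2 / 4))
    with (scal (x / 2) (bessel_series 1 (x ^ 2 / 4))) by (unfold scal; simpl; unfold mult; simpl; ring).
  apply (is_derive_comp (bessel_series 0) (fun x => x ^ 2 / 4)); auto.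
  auto_derive; auto. field.
Qed.

Lemma is_derive_besselI_S nu (x : R) :
  is_derive (besselI (S nu)) x (/ 2 * (besselI nu x + besselI (S (S nu)) x)).
Proof.
  apply (is_derive_ext (fun x => (x / 2) ^ (S nu) * bessel_series (S nu) (x ^ 2 / 4))).
  { intros y. rewrite besselI_series. reflexivity. }
  rewrite !besselI_series. pose proof (is_derive_bessel_series (S nu) (x ^ 2 / 4)) as H.
  rewrite (bessel_series_rec nu).
  evar_last.
  { apply (is_derive_mult (fun x => (x / 2) ^ (S nu)) (fun x => bessel_series (S nu) (x ^ 2 / 4)));
      [| |apply Rmult_comm].
    - auto_derive; [auto|reflexivity].
    - apply (is_derive_comp (bessel_series (S nu)) (fun x => x ^ 2 / 4) x _ (x / 2) H).
      auto_derive; auto. field. }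
  unfold plus, mult, scal; simpl; unfold mult; simpl.
  replace (match nu with 0%nat => 1 | S _ => INR nu + 1 end) with (INR nu + 1)
    by (destruct nu; simpl; ring).
  unfold Rdiv. field.
Qed.

Lemma besselI_rec nu x : x <> 0 ->
  besselI nu x - besselI (S (S nu)) x = 2 * (INR nu + 1) / x * besselI (S nu) x.
Proof.
  intros Hx. rewrite !besselI_series, (bessel_series_rec nu). simpl. field. auto.
Qed.

Lemma besselI_pos nu x : 0 < x -> 0 < besselI nu x.
Proof.
  intros Hx. rewrite besselI_series. apply Rmult_lt_0_compat; [apply pow_lt; lra|].
  apply bessel_series_pos. nra.
Qed.

Lemma besselI_nonneg nu x : 0 <= x -> 0 <= besselI nu x.
Proof.
  intros Hx. rewrite besselI_series. apply Rmult_le_pos; [apply pow_le; lra|].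
  apply Rlt_le, bessel_series_pos. nra.
Qed.

Lemma besselI_upper nu x X : 0 <= x <= X ->
  besselI nu x <= (X / 2) ^ nu / INR (fact nu) * exp (X ^ 2 / 4).
Proof.
  intros Hx. rewrite besselI_series. pose proof (INR_fact_pos nu).
  replace ((X / 2) ^ nu / INR (fact nu) * exp (X ^ 2 / 4))
    with ((X / 2) ^ nu * (exp (X ^ 2 / 4) / INR (fact nu))) by (field; lra).
  apply Rmult_le_compat.
  - apply pow_le; lra.
  - apply Rlt_le, bessel_series_pos. nra.
  - apply pow_incr. lra.
  - eapply Rle_trans; [apply bessel_series_upper; nra|].
    apply Rmult_le_compat_r; [apply Rlt_le, Rinv_0_lt_compat; auto|].
    destruct (Req_dec (x ^ 2 / 4) (X ^ 2 / 4)) as [->|]; [lra|].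
    apply Rlt_le, exp_increasing. nra.
Qed.

(** The symmetric derivative formula leads to the Kolmogorov equation; eliminating the lower order
    by the recurrence gives this form, whose quotient by [besselI nu x] is the logarithmic
    derivative appearing in the score. *)
Lemma is_derive_besselI nu (x : R) : x <> 0 ->
  is_derive (besselI nu) x (besselI (S nu) x + INR nu / x * besselI nu x).
Proof.
  intros Hx. destruct nu as [|nu].
  - replace (_ + _) with (besselI 1 x) by (simpl; field; auto). apply is_derive_besselI_0.
  - evar_last; [apply is_derive_besselI_S|]. pose proof (besselI_rec nu x Hx) as H.
    rewrite S_INR. replace (besselI nu x) with
      (besselI (S (S nu)) x + 2 * (INR nu + 1) / x * besselI (S nu) x) by lra. field. auto.
Qed.

Definition bessel_ratio (nu : nat) (x : R) : R := besselI (S nu) x / besselI nu x.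
(** Right-hand side of the Riccati equation of the ratio. All derivatives become polynomials in the
    ratio, [nu] and [/ x], so bounds on the ratio alone control them. *)
Definition bessel_ratio' (nu : nat) (x : R) : R :=
  1 - (2 * INR nu + 1) / x * bessel_ratio nu x - bessel_ratio nu x ^ 2.

(** A consequence of the termwise comparison [bessel_series_le]. The decay in [nu] compensates the
    factor [2 * nu + 1] of the Riccati equation. *)
Lemma bessel_ratio_bounds nu x : 0 < x ->
  0 <= bessel_ratio nu x /\ 2 * (INR nu + 1) * bessel_ratio nu x <= x.
Proof.
  intros Hx. unfold bessel_ratio. pose proof (besselI_pos nu x Hx). pose proof (besselI_pos (S nu) x Hx).
  split; [apply Rlt_le, Rdiv_lt_0_compat; auto|].
  replace (2 * (INR nu + 1) * (besselI (S nu) x / besselI nu x))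
    with (2 * (INR nu + 1) * besselI (S nu) x / besselI nu x) by (field; lra).
  apply Rle_div_l; [auto|]. rewrite !besselI_series.
  pose proof (bessel_series_le nu (x ^ 2 / 4) ltac:(nra)) as Hle.
  assert (0 < (x / 2) ^ nu) by (apply pow_lt; lra).
  replace (2 * (INR nu + 1) * ((x / 2) ^ S nu * bessel_series (S nu) (x ^ 2 / 4)))
    with (x * ((x / 2) ^ nu * ((INR nu + 1) * bessel_series (S nu) (x ^ 2 / 4)))) by (simpl; field).
  apply Rmult_le_compat_l; [lra|]. apply Rmult_le_compat_l; lra.
Qed.

Lemma is_derive_bessel_ratio nu (x : R) : 0 < x ->
  is_derive (bessel_ratio nu) x (bessel_ratio' nu x).
Proof.
  intros Hx. pose proof (besselI_pos nu x Hx) as Hp.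
  assert (Hx0 : x <> 0) by lra.
  pose proof (is_derive_besselI nu x Hx0) as H0. pose proof (is_derive_besselI_S nu x) as H1.
  unfold bessel_ratio. auto_derive.
  - repeat split; try (eexists; eassumption). lra.
  - rewrite_derive H0. rewrite_derive H1. unfold bessel_ratio', bessel_ratio.
    pose proof (besselI_rec nu x Hx0) as Hr.
    replace (besselI (S (S nu)) x) with
      (besselI nu x - 2 * (INR nu + 1) / x * besselI (S nu) x) by lra.
    field. split; lra.
Qed.

Definition pmf (x : R) (k : Z) : R := exp (- x) * besselI (Z.abs_nat k) x.

(** The forward equation of the symmetric walk with jump rate one, [x] being the time. The absolute
    value in [pmf] encodes the reflection of Bessel functions of integer order, so the equation
    keeps its form at [k = 0]. *)
Lemma is_derive_pmf_kolmogorov (k : Z) (x : R) :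
  is_derive (fun y => pmf y k) x (/ 2 * (pmf x (k - 1) + pmf x (k + 1)) - pmf x k).
Proof.
  unfold pmf.
  assert (H : forall nu d, is_derive (besselI nu) x d ->
    is_derive (fun y => exp (- y) * besselI nu y) x (exp (- x) * d - exp (- x) * besselI nu x)).
  { intros nu d H. auto_derive.
    - eexists; exact H.
    - rewrite_derive H. ring. }
  destruct k as [|k|k].
  - evar_last; [apply H, is_derive_besselI_0|]. simpl Z.abs_nat. change (Pos.to_nat 1) with 1%nat. field.
  - simpl Z.abs_nat at 1. destruct (Pos2Nat.is_succ k) as [n Hn].
    replace (Z.abs_nat (Z.pos k - 1)) with n by lia.
    replace (Z.abs_nat (Z.pos k + 1)) with (S (S n)) by lia.
    replace (Z.abs_nat (Z.pos k)) with (S n) by lia. rewrite Hn.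
    evar_last; [apply H, is_derive_besselI_S|]. field.
  - simpl Z.abs_nat at 1. destruct (Pos2Nat.is_succ k) as [n Hn].
    replace (Z.abs_nat (Z.neg k - 1)) with (S (S n)) by lia.
    replace (Z.abs_nat (Z.neg k + 1)) with n by lia.
    replace (Z.abs_nat (Z.neg k)) with (S n) by lia. rewrite Hn.
    evar_last; [apply H, is_derive_besselI_S|]. field.
Qed.

Lemma pmf_pos x k : 0 < x -> 0 < pmf x k.
Proof. intros Hx. apply Rmult_lt_0_compat; [apply exp_pos|apply besselI_pos; auto]. Qed.

Lemma pmf_nonneg x k : 0 <= x -> 0 <= pmf x k.
Proof. intros Hx. apply Rmult_le_pos; [apply Rlt_le, exp_pos|apply besselI_nonneg; auto]. Qed.

Lemma pmf_upper x X k : 0 <= x <= X ->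
  pmf x k <= exp (X ^ 2 / 4) * ((X / 2) ^ Z.abs_nat k / INR (fact (Z.abs_nat k))).
Proof.
  intros Hx. unfold pmf. pose proof (besselI_upper (Z.abs_nat k) x X Hx).
  pose proof (besselI_nonneg (Z.abs_nat k) x ltac:(lra)).
  assert (exp (- x) <= 1).
  { rewrite <- exp_0. destruct (Req_dec x 0) as [->|]; [rewrite Ropp_0; lra|].
    apply Rlt_le, exp_increasing. lra. }
  pose proof (exp_pos (- x)). nra.
Qed.

Definition score (x : R) (k : Z) : R := bessel_ratio (Z.abs_nat k) x + IZR (Z.abs k) / x - 1.
Definition score' (x : R) (k : Z) : R := bessel_ratio' (Z.abs_nat k) x - IZR (Z.abs k) / x ^ 2.
Definition score'' (x : R) (k : Z) : R :=
  let nu := IZR (Z.abs k) in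
  let h := bessel_ratio (Z.abs_nat k) x in
  let h' := bessel_ratio' (Z.abs_nat k) x in
  - (2 * nu + 1) / x * h' + (2 * nu + 1) / x ^ 2 * h - 2 * h * h' + 2 * nu / x ^ 3.

Lemma INR_abs_nat k : INR (Z.abs_nat k) = IZR (Z.abs k).
Proof. rewrite INR_IZR_INZ. f_equal. lia. Qed.

Lemma is_derive_pmf (k : Z) (x : R) : 0 < x ->
  is_derive (fun y => pmf y k) x (pmf x k * score x k).
Proof.
  intros Hx. pose proof (besselI_pos (Z.abs_nat k) x Hx).
  pose proof (is_derive_besselI (Z.abs_nat k) x ltac:(lra)) as H0.
  unfold pmf. auto_derive.
  - eexists; exact H0.
  - rewrite_derive H0. unfold score, bessel_ratio. rewrite INR_abs_nat. field. lra.
Qed.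

Lemma is_derive_ln_pmf (k : Z) (x : R) : 0 < x -> is_derive (fun y => ln (pmf y k)) x (score x k).
Proof.
  intros Hx. pose proof (is_derive_pmf k x Hx) as H. pose proof (pmf_pos x k Hx).
  replace (score x k) with (scal (pmf x k * score x k) (/ pmf x k))
    by (unfold scal; simpl; unfold mult; simpl; field; lra).
  apply (is_derive_comp ln (fun y => pmf y k)); auto.
  apply is_derive_Reals, derivable_pt_lim_ln; auto.
Qed.

Lemma is_derive_score (k : Z) (x : R) : 0 < x -> is_derive (fun y => score y k) x (score' x k).
Proof.
  intros Hx. pose proof (is_derive_bessel_ratio (Z.abs_nat k) x Hx) as H.
  unfold score. auto_derive.
  - repeat split; [eexists; exact H|lra].
  - rewrite_derive H. unfold score'. field. lra.
Qed.

Lemma is_derive_score' (k : Z) (x : R) : 0 < x -> is_derive (fun y => score' y k) x (score'' x k).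
Proof.
  intros Hx. pose proof (is_derive_bessel_ratio (Z.abs_nat k) x Hx) as H.
  unfold score', bessel_ratio' at 1. auto_derive.
  - repeat split; try (eexists; exact H); try lra; nra.
  - rewrite_derive H. unfold score''. rewrite INR_abs_nat. field. lra.
Qed.

Lemma score_bounds x1 x2 : 0 < x1 -> exists C, 0 <= C /\ forall x k, x1 <= x <= x2 ->
  Rabs (score x k) <= C * (1 + IZR (Z.abs k)) /\
  Rabs (score' x k) <= C * (1 + IZR (Z.abs k)) /\
  Rabs (score'' x k) <= C * (1 + IZR (Z.abs k)).
Proof.
  intros H1. set (U := / x1).
  destruct (Rle_dec x1 x2) as [H12|H12].
  2:{ exists 0. split; [lra|]. intros; lra. }
  assert (HU : 0 < U) by (apply Rinv_0_lt_compat; auto).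
  (* [U] bounds [/ x], [x2] bounds the ratio and [2 + x2 ^ 2] its derivative; the summands collect
     the terms of [score], [score'] and [score''], in this order. *)
  exists (1 + x2 + U + (2 + x2 ^ 2) + U ^ 2 + 2 * U * (2 + x2 ^ 2) + U + 2 * x2 * (2 + x2 ^ 2) + 2 * U ^ 3).
  split.
  { repeat apply Rplus_le_le_0_compat; try apply Rmult_le_pos; try nra. }
  intros x k Hx. unfold score'', score', score, bessel_ratio'. rewrite INR_abs_nat.
  destruct (bessel_ratio_bounds (Z.abs_nat k) x ltac:(lra)) as [Hh0 Hh1].
  rewrite INR_abs_nat in Hh1.
  set (h := bessel_ratio (Z.abs_nat k) x) in *.
  assert (Hnu : 0 <= IZR (Z.abs k)) by (apply IZR_le; lia).
  set (nu := IZR (Z.abs k)) in *.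
  clearbody h nu. unfold Rdiv.
  replace (/ x ^ 2) with ((/ x) ^ 2) by (field; lra).
  replace (/ x ^ 3) with ((/ x) ^ 3) by (field; lra).
  assert (Hu : 0 < / x <= U).
  { split; [apply Rinv_0_lt_compat; lra|]. apply Rinv_le_contravar; lra. }
  (* This product stays below one although [nu] is unbounded, which bounds the derivative of the
     ratio uniformly in [nu]. *)
  assert (Hhx : (2 * nu + 1) * / x * h <= 1).
  { replace ((2 * nu + 1) * / x * h) with ((2 * nu + 1) * h / x) by (field; lra).
    apply Rle_div_l; [lra|]. nra. }
  assert (Hhx0 : 0 <= (2 * nu + 1) * / x * h) by (repeat apply Rmult_le_pos; lra).
  set (u := / x) in *. set (a := (2 * nu + 1) * u * h) in *.
  assert (Hh2 : h <= x2) by nra.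
  assert (Hd : Rabs (1 - a - h ^ 2) <= 2 + x2 ^ 2) by (apply Rabs_le; split; nra).
  set (d := 1 - a - h ^ 2) in *.
  set (D := 2 + x2 ^ 2) in *. assert (HD : 2 <= D) by (unfold D; nra).
  assert (Hu2 : 0 <= u ^ 2 <= U ^ 2) by (split; [nra|apply pow_incr; lra]).
  assert (Hu3 : 0 <= u ^ 3 <= U ^ 3) by (split; [apply pow_le; lra|apply pow_incr; lra]).
  assert (HU2 : 0 <= U ^ 2) by lra. assert (HU3 : 0 <= U ^ 3) by lra.
  assert (Hx20 : 0 <= x2) by lra.
  assert (HxD : 0 <= x2 * D) by nra. assert (HUD : 0 <= U * D) by nra.
  repeat split.
  - apply Rabs_le. split; nra.
  - eapply Rle_trans; [apply Rabs_triang|]. rewrite Rabs_Ropp, (Rabs_pos_eq (nu * u ^ 2)) by nra. nra.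
  - assert (T1 : Rabs (- (2 * nu + 1) * u * d) <= 2 * (1 + nu) * (U * D)).
    { rewrite !Rabs_mult, Rabs_Ropp, (Rabs_pos_eq (2 * nu + 1)), (Rabs_pos_eq u) by lra.
      rewrite Rmult_assoc. apply Rmult_le_compat; try lra.
      - apply Rmult_le_pos; [lra|apply Rabs_pos].
      - apply Rmult_le_compat; try lra. apply Rabs_pos. }
    assert (T2 : Rabs ((2 * nu + 1) * u ^ 2 * h) <= U).
    { replace ((2 * nu + 1) * u ^ 2 * h) with (u * a) by (unfold a; ring).
      rewrite Rabs_pos_eq by nra. nra. }
    assert (T3 : Rabs (2 * h * d) <= 2 * (x2 * D)).
    { rewrite !Rabs_mult, (Rabs_pos_eq 2), (Rabs_pos_eq h) by lra. rewrite Rmult_assoc.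
      apply Rmult_le_compat_l; [lra|]. apply Rmult_le_compat; try lra. apply Rabs_pos. }
    assert (T4 : Rabs (2 * nu * u ^ 3) <= 2 * nu * U ^ 3).
    { rewrite Rabs_pos_eq by nra. apply Rmult_le_compat_l; lra. }
    apply Rabs_le_between in T1. apply Rabs_le_between in T2. apply Rabs_le_between in T3.
    apply Rabs_le_between in T4. apply Rabs_le.
    assert (0 <= nu * (1 + x2 + U + D + U ^ 2 + U + 2 * (x2 * D))) by (apply Rmult_le_pos; lra).
    split; nra.
Qed.

(** * Truncated moments of the increment law *)

Definition box (M : nat) (g : Z -> R) : R :=
  sum_f_R0 (fun j => g (Z.of_nat j - Z.of_nat M)%Z) (2 * M).

Lemma box_0 g : box 0 g = g 0%Z.
Proof. reflexivity. Qed.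

Lemma box_S M g :
  box (S M) g = box M g + g (Z.of_nat (S M)) + g (- Z.of_nat (S M))%Z.
Proof.
  unfold box. replace (2 * S M)%nat with (S (S (2 * M))) by lia.
  rewrite tech5, decomp_sum by lia. rewrite Nat.pred_succ.
  replace (Z.of_nat 0 - Z.of_nat (S M))%Z with (- Z.of_nat (S M))%Z by lia.
  replace (Z.of_nat (S (S (2 * M))) - Z.of_nat (S M))%Z with (Z.of_nat (S M)) by lia.
  rewrite (sum_eq _ (fun j => g (Z.of_nat j - Z.of_nat M)%Z)).
  - ring.
  - intros i _. f_equal. lia.
Qed.

Lemma box_ext M f g : (forall k, f k = g k) -> box M f = box M g.
Proof. intros H. apply sum_eq. intros; apply H. Qed.

Lemma box_le M f g : (forall k, f k <= g k) -> box M f <= box M g.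
Proof. intros H. apply sum_Rle. intros; apply H. Qed.

Lemma box_plus M f g : box M (fun k => f k + g k) = box M f + box M g.
Proof. apply sum_plus. Qed.

Lemma box_scal M c f : box M (fun k => c * f k) = c * box M f.
Proof. unfold box. rewrite scal_sum. apply sum_eq. intros; ring. Qed.

Lemma box_laplacian M (q : Z -> R) :
  box M (fun k => / 2 * (q (k - 1)%Z + q (k + 1)%Z) - q k)
  = / 2 * (q (Z.of_nat (S M)) + q (- Z.of_nat (S M))%Z - q (Z.of_nat M) - q (- Z.of_nat M)%Z).
Proof.
  induction M as [|M IH].
  - rewrite box_0. simpl. field.
  - rewrite box_S, IH.
    replace (Z.of_nat (S M) - 1)%Z with (Z.of_nat M) by lia.
    replace (Z.of_nat (S M) + 1)%Z with (Z.of_nat (S (S M))) by lia.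
    replace (- Z.of_nat (S M) - 1)%Z with (- Z.of_nat (S (S M)))%Z by lia.
    replace (- Z.of_nat (S M) + 1)%Z with (- Z.of_nat M)%Z by lia. field.
Qed.

Lemma is_derive_box M (g : R -> Z -> R) (g' : Z -> R) (x : R) :
  (forall k, is_derive (fun y => g y k) x (g' k)) ->
  is_derive (fun y => box M (g y)) x (box M g').
Proof.
  intros H. unfold box. induction (2 * M)%nat as [|n IH]; simpl; [apply H|].
  apply (is_derive_plus (V := R_NormedModule)); [apply IH|apply H].
Qed.

Definition trunc (x : R) (M : nat) (f : Z -> R) : R := box M (fun k => pmf x k * f k).

Lemma trunc_positive_linear x M : 0 <= x -> positive_linear (trunc x M).
Proof.
  intros Hx. split.
  - intros f g H. apply box_le. intros k. apply Rmult_le_compat_l; auto. apply pmf_nonneg; auto.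
  - intros f g. unfold trunc. rewrite <- box_plus. apply box_ext. intros; ring.
  - intros c f. unfold trunc. rewrite <- box_scal. apply box_ext. intros; ring.
Qed.

Lemma trunc_mono x M f : 0 <= x -> (forall k, 0 <= f k) -> trunc x M f <= trunc x (S M) f.
Proof.
  intros Hx Hf. unfold trunc. rewrite box_S.
  assert (H : forall k, 0 <= pmf x k * f k)
    by (intros; apply Rmult_le_pos; [apply pmf_nonneg|]; auto).
  pose proof (H (Z.of_nat (S M))). pose proof (H (- Z.of_nat (S M))%Z). lra.
Qed.

(** At time 0 the walk has not moved, so every box has full mass: the initial value from which the
    mass is followed in [x]. *)
Lemma trunc_0 M : trunc 0 M (fun _ => 1) = 1.
Proof.
  assert (H : forall nu, besselI nu 0 = if Nat.eqb nu 0 then 1 else 0).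
  { intros nu. rewrite besselI_series. unfold bessel_series.
    replace (0 ^ 2 / 4) with 0 by field. rewrite PSeries_0. unfold Rdiv. rewrite Rmult_0_l.
    destruct nu as [|nu]; [unfold bessel_coef|]; simpl; [field|ring]. }
  unfold trunc. induction M as [|M IH].
  - rewrite box_0. unfold pmf. simpl Z.abs_nat. rewrite H, Ropp_0, exp_0. simpl. ring.
  - rewrite box_S, IH. unfold pmf. rewrite !H.
    replace (Z.abs_nat (Z.of_nat (S M))) with (S M) by lia.
    replace (Z.abs_nat (- Z.of_nat (S M))) with (S M) by lia. simpl. ring.
Qed.

Lemma one_plus_abs_le k : 0 <= IZR (Z.abs k) /\ 1 + IZR (Z.abs k) <= 2 ^ Z.abs_nat k.
Proof.
  rewrite <- INR_abs_nat. split; [apply pos_INR|].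
  induction (Z.abs_nat k) as [|n IH]; [simpl; lra|]. rewrite S_INR. simpl.
  pose proof (pos_INR n). lra.
Qed.

(** By [1 + |k| <= 2 ^ |k|], a weight of degree [j] merely multiplies the base of the exponential
    series by [2 ^ j]; all moment bounds come from this. *)
Lemma weighted_pmf_le x X k j : 0 <= x <= X ->
  pmf x k * (1 + IZR (Z.abs k)) ^ j
  <= exp (X ^ 2 / 4) * ((2 ^ j * (X / 2)) ^ Z.abs_nat k / INR (fact (Z.abs_nat k))).
Proof.
  intros Hx. pose proof (one_plus_abs_le k) as [H0 H1].
  pose proof (pmf_upper x X k Hx) as H2. pose proof (pmf_nonneg x k ltac:(lra)).
  assert (H3 : (1 + IZR (Z.abs k)) ^ j <= (2 ^ j) ^ Z.abs_nat k).
  { rewrite <- pow_mult, Nat.mul_comm, pow_mult. apply pow_incr. lra. }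
  assert (0 <= (1 + IZR (Z.abs k)) ^ j) by (apply pow_le; lra).
  eapply Rle_trans; [apply Rmult_le_compat; eauto|].
  rewrite Rpow_mult_distr. apply Req_le. field. apply Rgt_not_eq, INR_fact_pos.
Qed.

Lemma sum_exp_le y n : 0 <= y -> sum_f_R0 (fun i => y ^ i / INR (fact i)) n <= exp y.
Proof.
  intros Hy. destruct (Series_exp y) as [E Hex]. rewrite <- E.
  apply Rle_trans with (sum_n (fun m => / INR (fact m) * y ^ m) n).
  - rewrite sum_n_Reals. apply sum_Rle. intros i _. apply Req_le. unfold Rdiv. ring.
  - apply (is_lim_seq_incr_compare (sum_n (fun m => / INR (fact m) * y ^ m))).
    + apply (Series_correct _ Hex).
    + intros m. rewrite sum_Sn. unfold plus; simpl.
      assert (0 <= / INR (fact (S m)) * y ^ S m).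
      { apply Rmult_le_pos; [apply Rlt_le, Rinv_0_lt_compat, INR_fact_pos|apply pow_le; auto]. }
      simpl in *. lra.
Qed.

Lemma box_abs_nat_le M (u : nat -> R) : (forall n, 0 <= u n) ->
  box M (fun k => u (Z.abs_nat k)) <= 2 * sum_f_R0 u M.
Proof.
  intros Hu. induction M as [|M IH].
  - rewrite box_0. simpl. specialize (Hu 0%nat). lra.
  - rewrite box_S. replace (Z.abs_nat (Z.of_nat (S M))) with (S M) by lia.
    replace (Z.abs_nat (- Z.of_nat (S M))) with (S M) by lia. rewrite tech5. lra.
Qed.

Lemma moment_bound X j : exists K, 0 <= K /\ forall x M, 0 <= x <= X ->
  trunc x M (fun k => (1 + IZR (Z.abs k)) ^ j) <= K.
Proof.
  destruct (Rle_dec 0 X) as [HX|HX].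
  2:{ exists 0. split; [lra|]. intros; lra. }
  exists (2 * (exp (X ^ 2 / 4) * exp (2 ^ j * (X / 2)))). split.
  { pose proof (exp_pos (X ^ 2 / 4)). pose proof (exp_pos (2 ^ j * (X / 2))). nra. }
  intros x M Hx. assert (Hy : 0 <= 2 ^ j * (X / 2)).
  { apply Rmult_le_pos; [apply pow_le; lra|lra]. }
  unfold trunc. eapply Rle_trans.
  { apply box_le. intros k. apply weighted_pmf_le, Hx. }
  rewrite box_scal. rewrite <- Rmult_assoc, (Rmult_comm 2), Rmult_assoc.
  apply Rmult_le_compat_l; [apply Rlt_le, exp_pos|].
  eapply Rle_trans.
  { apply (box_abs_nat_le M (fun n => (2 ^ j * (X / 2)) ^ n / INR (fact n))).
    intros n. apply Rmult_le_pos; [apply pow_le; auto|].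
    apply Rlt_le, Rinv_0_lt_compat, INR_fact_pos. }
  apply Rmult_le_compat_l; [lra|]. apply sum_exp_le, Hy.
Qed.

Lemma weighted_pmf_vanishes x j : 0 <= x ->
  is_lim_seq (fun M => pmf x (Z.of_nat M) * (1 + IZR (Z.abs (Z.of_nat M))) ^ j) 0.
Proof.
  intros Hx.
  apply (is_lim_seq_le_le (fun _ => 0) _
    (fun M => exp (x ^ 2 / 4) * ((2 ^ j * (x / 2)) ^ M / INR (fact M)))).
  - intros M. split.
    + apply Rmult_le_pos; [apply pmf_nonneg; auto|]. apply pow_le.
      pose proof (one_plus_abs_le (Z.of_nat M)). lra.
    + eapply Rle_trans; [apply (weighted_pmf_le x x); lra|].
      replace (Z.abs_nat (Z.of_nat M)) with M by lia. lra.
  - apply is_lim_seq_const.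
  - replace (Finite 0) with (Rbar_mult (exp (x ^ 2 / 4)) 0) by (simpl; f_equal; ring).
    apply is_lim_seq_scal_l. apply is_lim_seq_Reals, cv_speed_pow_fact.
Qed.

Lemma pmf_even x k : pmf x (- k) = pmf x k.
Proof. unfold pmf. do 2 f_equal. lia. Qed.

Lemma score_even x k : score x (- k) = score x k.
Proof.
  unfold score. replace (Z.abs_nat (- k)) with (Z.abs_nat k) by lia.
  rewrite Z.abs_opp. reflexivity.
Qed.

Lemma trunc_mass_derive M (x : R) :
  is_derive (fun y => trunc y M (fun _ => 1)) x
    (pmf x (Z.of_nat (S M)) - pmf x (Z.of_nat M)).
Proof.
  apply (is_derive_ext (fun y => box M (pmf y))).
  { intros y. apply box_ext. intros; ring. }
  evar_last; [apply is_derive_box; intros k; apply is_derive_pmf_kolmogorov|].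
  rewrite (box_laplacian M (pmf x)), !pmf_even. field.
Qed.

(** No generating function is used: the truncated mass starts at one for [x = 0], and its derivative
    consists of boundary terms that vanish uniformly on [[0, x]] as the box grows. *)
Lemma trunc_mass_cv x : 0 <= x -> is_lim_seq (fun M => trunc x M (fun _ => 1)) 1.
Proof.
  intros Hx.
  set (b := fun M => exp (x ^ 2 / 4) * ((x / 2) ^ M / INR (fact M))).
  assert (Hb : is_lim_seq b 0).
  { replace (Finite 0) with (Rbar_mult (exp (x ^ 2 / 4)) 0) by (simpl; f_equal; ring).
    apply is_lim_seq_scal_l. apply is_lim_seq_Reals, cv_speed_pow_fact. }
  assert (Hlim : is_lim_seq (fun M => (b (S M) + b M) * x) 0).
  { replace 0 with ((0 + 0) * x) by ring.
    apply (is_lim_seq_scal_r (fun M => b (S M) + b M) x (Finite (0 + 0))).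
    apply (is_lim_seq_plus' (fun M => b (S M)) b); auto. apply (is_lim_seq_incr_1 b), Hb. }
  apply (is_lim_seq_ext (fun M => 1 + (trunc x M (fun _ => 1) - 1))); [intros; ring|].
  replace (Finite 1) with (Finite (1 + 0)) by (f_equal; ring).
  apply is_lim_seq_plus'; [apply is_lim_seq_const|].
  apply is_lim_seq_abs_0.
  apply (is_lim_seq_le_le (fun _ => 0) _ (fun M => (b (S M) + b M) * x)); auto.
  2: apply is_lim_seq_const.
  intros M. split; [apply Rabs_pos|].
  replace (trunc x M (fun _ => 1) - 1) with (trunc x M (fun _ => 1) - trunc 0 M (fun _ => 1))
    by (rewrite trunc_0; ring).
  replace ((b (S M) + b M) * x) with ((b (S M) + b M) * Rabs (x - 0)) by (rewrite Rminus_0_r, Rabs_pos_eq; auto).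
  apply (mean_value_abs (fun y => trunc y M (fun _ => 1))
    (fun t => pmf t (Z.of_nat (S M)) - pmf t (Z.of_nat M)) 0 x).
  - intros t Ht. apply trunc_mass_derive.
  - intros t Ht. rewrite Rmin_left, Rmax_right in Ht by lra.
    assert (Hp : forall N, 0 <= pmf t (Z.of_nat N) <= b N).
    { intros N. split; [apply pmf_nonneg; lra|]. unfold b.
      rewrite <- (Zabs2Nat.id N) at 2 3. apply pmf_upper; auto. }
    pose proof (Hp M). pose proof (Hp (S M)). apply Rabs_le. split; lra.
Qed.

Lemma trunc_mass_le x M : 0 <= x -> trunc x M (fun _ => 1) <= 1.
Proof.
  intros Hx. apply (is_lim_seq_incr_compare (fun M => trunc x M (fun _ => 1))).
  - apply trunc_mass_cv; auto.
  - intros n. apply trunc_mono; auto. intros; lra.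
Qed.

Lemma pmf_score_kolmogorov x k : 0 < x ->
  pmf x k * score x k = / 2 * (pmf x (k - 1) + pmf x (k + 1)) - pmf x k.
Proof.
  intros Hx. rewrite <- (is_derive_unique _ _ _ (is_derive_pmf k x Hx)).
  apply is_derive_unique, is_derive_pmf_kolmogorov.
Qed.

Lemma pmf_score_derive (k : Z) (x : R) : 0 < x ->
  is_derive (fun y => pmf y k * score y k) x (pmf x k * (score' x k + score x k ^ 2)).
Proof.
  intros Hx. evar_last.
  - apply (is_derive_mult (fun y => pmf y k) (fun y => score y k));
      [apply is_derive_pmf; auto|apply is_derive_score; auto|apply Rmult_comm].
  - unfold plus, mult; simpl. ring.
Qed.

(** The operator on the right of [pmf_score_kolmogorov] does not depend on [x], so differentiating
    that identity shows that [pmf * score] solves the Kolmogorov equation too and its sums telescope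
    as well. *)
Lemma pmf_score'_kolmogorov x k : 0 < x ->
  pmf x k * (score' x k + score x k ^ 2) =
  / 2 * (pmf x (k - 1) * score x (k - 1) + pmf x (k + 1) * score x (k + 1)) - pmf x k * score x k.
Proof.
  intros Hx. rewrite <- (is_derive_unique _ _ _ (pmf_score_derive k x Hx)).
  apply is_derive_unique.
  apply (is_derive_ext_loc (fun y => / 2 * (pmf y (k - 1) + pmf y (k + 1)) - pmf y k)).
  - exists (mkposreal x Hx). intros y Hy. symmetry. apply pmf_score_kolmogorov.
    unfold ball in Hy; simpl in Hy. unfold AbsRing_ball, abs, minus, plus, opp in Hy; simpl in Hy.
    apply Rabs_def2 in Hy. lra.
  - apply (is_derive_minus (V := R_NormedModule)); [|apply is_derive_pmf; auto].
    apply (is_derive_scal (fun y => pmf y (k - 1) + pmf y (k + 1))).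
    apply (is_derive_plus (V := R_NormedModule)); apply is_derive_pmf; auto.
Qed.

Lemma score_bound_at x : 0 < x -> exists C, 0 <= C /\ forall k,
  Rabs (score x k) <= C * (1 + IZR (Z.abs k)).
Proof.
  intros Hx. destruct (score_bounds x x Hx) as [C [HC H]]. exists C. split; auto.
  intros k. apply (H x k). lra.
Qed.

Lemma trunc_score_cv x : 0 < x -> is_lim_seq (fun M => trunc x M (score x)) 0.
Proof.
  intros Hx.
  apply (is_lim_seq_ext (fun M => pmf x (Z.of_nat (S M)) - pmf x (Z.of_nat M))).
  { intros M. unfold trunc. rewrite (box_ext M _ _ (fun k => pmf_score_kolmogorov x k Hx)).
    rewrite (box_laplacian M (pmf x)), !pmf_even. field. }
  assert (H : is_lim_seq (fun M => pmf x (Z.of_nat M)) 0).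
  { eapply is_lim_seq_ext; [|apply (weighted_pmf_vanishes x 0); lra]. intros; simpl; ring. }
  replace (Finite 0) with (Finite (0 - 0)) by (f_equal; ring).
  apply is_lim_seq_minus'; auto. apply (is_lim_seq_incr_1 (fun M => pmf x (Z.of_nat M))), H.
Qed.

(** The second Bartlett identity: the boundary terms vanish because the score grows linearly while
    the law decays factorially. *)
Lemma trunc_score'_cv x : 0 < x ->
  is_lim_seq (fun M => trunc x M (fun k => score' x k + score x k ^ 2)) 0.
Proof.
  intros Hx.
  apply (is_lim_seq_ext (fun M => pmf x (Z.of_nat (S M)) * score x (Z.of_nat (S M))
                                  - pmf x (Z.of_nat M) * score x (Z.of_nat M))).
  { intros M. unfold trunc. rewrite (box_ext M _ _ (fun k => pmf_score'_kolmogorov x k Hx)).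
    rewrite (box_laplacian M (fun k => pmf x k * score x k)), !pmf_even, !score_even. field. }
  assert (H : is_lim_seq (fun M => pmf x (Z.of_nat M) * score x (Z.of_nat M)) 0).
  { destruct (score_bound_at x Hx) as [C [HC HS]].
    apply is_lim_seq_abs_0.
    apply (is_lim_seq_le_le (fun _ => 0) _
      (fun M => C * (pmf x (Z.of_nat M) * (1 + IZR (Z.abs (Z.of_nat M))) ^ 1))).
    - intros M. split; [apply Rabs_pos|].
      pose proof (pmf_nonneg x (Z.of_nat M) ltac:(lra)). rewrite Rabs_mult, (Rabs_pos_eq (pmf _ _)) by auto.
      specialize (HS (Z.of_nat M)). rewrite pow_1. nra.
    - apply is_lim_seq_const.
    - replace (Finite 0) with (Rbar_mult C 0) by (simpl; f_equal; ring).
      apply is_lim_seq_scal_l, weighted_pmf_vanishes. lra. }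
  replace (Finite 0) with (Finite (0 - 0)) by (f_equal; ring).
  apply is_lim_seq_minus'; auto.
  apply (is_lim_seq_incr_1 (fun M => pmf x (Z.of_nat M) * score x (Z.of_nat M))), H.
Qed.

Definition fisher (x : R) : R := lim_seq (fun M => trunc x M (fun k => score x k ^ 2)).

Lemma phi_fisher theta Delta : phi theta Delta = fisher (theta * Delta).
Proof. reflexivity. Qed.

Lemma trunc_le_moment x M f C j : 0 <= x ->
  (forall k, f k <= C * (1 + IZR (Z.abs k)) ^ j) ->
  trunc x M f <= C * trunc x M (fun k => (1 + IZR (Z.abs k)) ^ j).
Proof.
  intros Hx Hf. pose proof (trunc_positive_linear x M Hx) as HA.
  rewrite <- (pl_scal _ HA). apply (pl_le _ HA), Hf.
Qed.

(** Monotone in [M] and bounded by a second moment, so the epsilon-chosen value is a true limit. *)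
Lemma fisher_cv x : 0 < x ->
  is_lim_seq (fun M => trunc x M (fun k => score x k ^ 2)) (fisher x).
Proof.
  intros Hx. destruct (score_bound_at x Hx) as [C [HC HS]].
  destruct (moment_bound x 2) as [K [HK0 HK]].
  destruct (ex_finite_lim_seq_incr (fun M => trunc x M (fun k => score x k ^ 2)) (C ^ 2 * K)) as [l Hl].
  - intros n. apply trunc_mono; [lra|]. intros; apply pow2_ge_0.
  - intros M. eapply Rle_trans; [apply (trunc_le_moment x M _ (C ^ 2) 2); [lra|]|].
    + intros k. rewrite <- Rpow_mult_distr, <- (pow2_abs (score x k)). apply pow_incr.
      split; [apply Rabs_pos|apply HS].
    + apply Rmult_le_compat_l; [apply pow2_ge_0|]. apply HK. lra.
  - replace (fisher x) with l; auto. symmetry. apply lim_seq_eq, is_lim_seq_Reals, Hl.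
Qed.

(** One lattice point with nonzero score suffices; any [k > x] works, since the ratio is nonnegative
    and [k / x > 1]. *)
Lemma fisher_pos x : 0 < x -> 0 < fisher x.
Proof.
  intros Hx. destruct (INR_unbounded x) as [N HN].
  set (k := Z.of_nat (S N)).
  assert (Hk : x < IZR (Z.abs k)).
  { unfold k. rewrite <- INR_abs_nat. replace (Z.abs_nat (Z.of_nat (S N))) with (S N) by lia.
    rewrite S_INR. lra. }
  assert (Hs : 0 < score x k).
  { unfold score. destruct (bessel_ratio_bounds (Z.abs_nat k) x Hx).
    assert (1 < IZR (Z.abs k) / x) by (apply Rlt_div_r; lra). lra. }
  apply Rlt_le_trans with (pmf x k * score x k ^ 2).
  { apply Rmult_lt_0_compat; [apply pmf_pos; auto|nra]. }
  apply Rle_trans with (trunc x (S N) (fun k => score x k ^ 2)).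
  - unfold trunc. rewrite box_S. fold k.
    assert (H : forall j, 0 <= pmf x j * score x j ^ 2).
    { intros j. apply Rmult_le_pos; [apply pmf_nonneg; lra|apply pow2_ge_0]. }
    pose proof (H (- k)%Z). assert (0 <= box N (fun k => pmf x k * score x k ^ 2)).
    { apply cond_pos_sum. intros; apply H. }
    lra.
  - apply (is_lim_seq_incr_compare (fun M => trunc x M (fun k => score x k ^ 2))).
    + apply fisher_cv; auto.
    + intros n. apply trunc_mono; [lra|]. intros; apply pow2_ge_0.
Qed.

(** Only truncated informations are differentiated. The derivative is the mean of
    [score ^ 3 + 2 * score * score'], bounded by third moments uniformly in [M], so the estimate
    survives the limit. *)
Lemma fisher_lipschitz x1 x2 : 0 < x1 -> exists K, forall x y,
  x1 <= x <= x2 -> x1 <= y <= x2 -> Rabs (fisher y - fisher x) <= K * Rabs (y - x).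
Proof.
  intros H1. destruct (score_bounds x1 x2 H1) as [C [HC HS]].
  destruct (moment_bound x2 3) as [K [HK0 HK]].
  exists ((C ^ 3 + 2 * C ^ 2) * K). intros x y Hx Hy.
  assert (Hd : forall M, Rabs (trunc y M (fun k => score y k ^ 2) - trunc x M (fun k => score x k ^ 2))
                <= (C ^ 3 + 2 * C ^ 2) * K * Rabs (y - x)).
  { intros M. unfold trunc.
    assert (Hsub : forall t, Rmin x y <= t <= Rmax x y -> x1 <= t <= x2).
    { intros t. unfold Rmin, Rmax. destruct (Rle_dec x y); lra. }
    apply (mean_value_abs (fun t => box M (fun k => pmf t k * score t k ^ 2))
      (fun t => trunc t M (fun k => score t k ^ 3 + 2 * (score t k * score' t k)))).
    - intros t Ht. apply Hsub in Ht. apply (is_derive_box M (fun t k => pmf t k * score t k ^ 2)).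
      intros k. apply (is_derive_ext (fun t => pmf t k * score t k * score t k));
        [intros; simpl; rewrite Rmult_1_r; apply Rmult_assoc|].
      evar_last.
      + apply (is_derive_mult (fun y => pmf y k * score y k) (fun y => score y k));
          [apply pmf_score_derive|apply is_derive_score|apply Rmult_comm]; lra.
      + unfold plus, mult; simpl. ring.
    - intros t Ht. apply Hsub in Ht.
      pose proof (trunc_positive_linear t M ltac:(lra)) as HA.
      eapply Rle_trans; [apply (pl_abs _ HA _ (fun k => (C ^ 3 + 2 * C ^ 2) * (1 + IZR (Z.abs k)) ^ 3))|].
      + intros k. destruct (HS t k Ht) as [S0 [S1 _]]. pose proof (one_plus_abs_le k) as [W _].
        set (w := 1 + IZR (Z.abs k)) in *. assert (1 <= w) by (unfold w; lra).
        assert (E3 : Rabs (score t k ^ 3) <= C ^ 3 * w ^ 3).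
        { rewrite <- RPow_abs, <- Rpow_mult_distr. apply pow_incr. split; [apply Rabs_pos|auto]. }
        assert (E2 : Rabs (score t k * score' t k) <= C ^ 2 * w ^ 2).
        { rewrite Rabs_mult. replace (C ^ 2 * w ^ 2) with ((C * w) * (C * w)) by ring.
          apply Rmult_le_compat; auto; apply Rabs_pos. }
        assert (C ^ 2 * w ^ 2 <= C ^ 2 * w ^ 3).
        { apply Rmult_le_compat_l; [apply pow2_ge_0|]. apply Rle_pow; auto. }
        eapply Rle_trans; [apply Rabs_triang|]. rewrite (Rabs_mult 2), (Rabs_pos_eq 2) by lra. lra.
      + rewrite (pl_scal _ HA). apply Rmult_le_compat_l; [|apply HK; lra].
        assert (0 <= C ^ 3) by (apply pow_le; auto). nra. }
  apply (is_lim_seq_le (fun M => Rabs (trunc y M (fun k => score y k ^ 2) - trunc x M (fun k => score x k ^ 2)))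
    (fun _ => (C ^ 3 + 2 * C ^ 2) * K * Rabs (y - x)) (Rabs (fisher y - fisher x))
    ((C ^ 3 + 2 * C ^ 2) * K * Rabs (y - x))); auto.
  - apply (is_lim_seq_abs _ (Finite (fisher y - fisher x))).
    apply is_lim_seq_minus'; apply fisher_cv; lra.
  - apply is_lim_seq_const.
Qed.

(** * Estimates at a fixed horizon *)

Lemma boxsum_ext n : forall M g h, (forall l, g l = h l) -> boxsum n M g = boxsum n M h.
Proof.
  induction n as [|n IH]; intros M g h H; simpl; auto.
  apply sum_eq. intros i _. apply IH. intros; apply H.
Qed.

Lemma boxsum_scal n : forall M c g, boxsum n M (fun l => c * g l) = c * boxsum n M g.
Proof.
  induction n as [|n IH]; intros M c g; simpl; auto.
  rewrite scal_sum. apply sum_eq. intros i _. rewrite Rmult_comm.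
  apply (IH M c (fun ks => g ((Z.of_nat i - Z.of_nat M)%Z :: ks))).
Qed.

Lemma boxsum_iter_expect Delta theta M n : forall g,
  boxsum n M (fun k => prod_f Delta theta k * g k) = iter_expect (trunc (theta * Delta) M) n g.
Proof.
  induction n as [|n IH]; intros g; simpl; [ring|].
  unfold trunc at 1, box. simpl. apply sum_eq. intros i _.
  rewrite <- IH, <- boxsum_scal. apply boxsum_ext. intros l.
  unfold prod_f, fD, pmf. simpl. ring.
Qed.

(** The box sums increase with [M] because [g >= 0] and stay below one because [g <= 1] on a
    sub-probability. This gives access to [expect] for indicators. *)
Lemma expect_cv T Delta theta g : 0 < theta * Delta -> (forall l, 0 <= g l <= 1) ->
  is_lim_seq (fun M => iter_expect (trunc (theta * Delta) M) (nobs T Delta) (fun k => g (obs k)))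
    (expect T Delta theta g).
Proof.
  intros Hx Hg. set (x := theta * Delta) in *.
  set (u := fun M => iter_expect (trunc x M) (nobs T Delta) (fun k => g (obs k))).
  assert (HA : forall M, positive_linear (trunc x M)) by (intros; apply trunc_positive_linear; lra).
  destruct (ex_finite_lim_seq_incr u 1) as [l Hl].
  - intros M. apply iter_expect_mono_functional; auto.
    + intros f Hf. apply trunc_mono; auto. lra.
    + intros k. apply Hg.
  - intros M. eapply Rle_trans; [apply Rle_abs|]. apply ie_abs_bound; auto; try lra.
    + apply trunc_mass_le. lra.
    + intros k _. rewrite Rabs_pos_eq; apply Hg.
  - replace (expect T Delta theta g) with l; auto.
    symmetry. apply lim_seq_eq, is_lim_seq_Reals.
    apply (is_lim_seq_ext u); auto. intros M. unfold u, x. symmetry.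
    apply (boxsum_iter_expect Delta theta M (nobs T Delta) (fun k => g (obs k))).
Qed.

Lemma ind_bounds b : 0 <= ind b <= 1.
Proof. destruct b; simpl; lra. Qed.

Lemma Rle_b_true a b : a <= b -> Rle_b a b = true.
Proof. unfold Rle_b. destruct (Rle_dec a b); intuition. Qed.

Lemma Rle_b_false a b : b < a -> Rle_b a b = false.
Proof. unfold Rle_b. destruct (Rle_dec a b); intros; auto; lra. Qed.

Lemma trunc_score_moments x1 x2 : 0 < x1 -> exists K, 0 <= K /\ forall x M, x1 <= x <= x2 ->
  trunc x M (fun k => Rabs (score x k)) <= K /\
  trunc x M (fun k => Rabs (score x k) ^ 3) <= K.
Proof.
  intros H1. destruct (score_bounds x1 x2 H1) as [C [HC HS]].
  destruct (moment_bound x2 3) as [K [HK0 HK]].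
  assert (HC3 : 0 <= C ^ 3) by (apply pow_le; auto).
  exists ((C + C ^ 3) * K). split; [apply Rmult_le_pos; lra|].
  intros x M Hx. specialize (HK x M ltac:(lra)).
  assert (Hw : forall k, 1 <= 1 + IZR (Z.abs k)) by (intros k; pose proof (one_plus_abs_le k); lra).
  split.
  - eapply Rle_trans; [apply (trunc_le_moment x M _ C 3); [lra|]|nra].
    intros k. destruct (HS x k Hx) as [S0 _]. eapply Rle_trans; [apply S0|].
    apply Rmult_le_compat_l; auto. rewrite <- (pow_1 (1 + IZR (Z.abs k))) at 1.
    apply Rle_pow; auto.
  - eapply Rle_trans; [apply (trunc_le_moment x M _ (C ^ 3) 3); [lra|]|nra].
    intros k. destruct (HS x k Hx) as [S0 _]. rewrite <- Rpow_mult_distr. apply pow_incr.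
    split; [apply Rabs_pos|auto].
Qed.

(** The Stein equation turns the left-hand side into the defect bounded by [stein_iter] at shift 0.
    The mean [c] is multiplied by [m0 ^ n], the mass of the box law; the last term pays for a
    variance [n * m2] different from one. *)
Lemma clt_truncated x M n s K c B F F1 g :
  0 < x -> 0 < s ->
  trunc x M (fun k => Rabs (score x k)) <= K -> trunc x M (fun k => Rabs (score x k) ^ 3) <= K ->
  0 <= B ->
  (forall t, F1 t - t * F t = g t - c) ->
  (forall t, Rabs (F t) <= B) -> (forall t, Rabs (F1 t) <= B) ->
  (forall y h, Rabs (F1 (y + h) - F1 y) <= B * Rabs h) ->
  (forall y h, Rabs (F (y + h) - F y - h * F1 y) <= B * h ^ 2) ->
  let m0 := trunc x M (fun _ => 1) in
  let m1 := trunc x M (score x) in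
  let m2 := s ^ 2 * trunc x M (fun k => score x k ^ 2) in
  Rabs (iter_expect (trunc x M) n (fun l => g (lsum (fun k => s * score x k) l)) - c * m0 ^ n)
  <= INR n * (B * (s * Rabs m1) + m2 * (B * (1 - m0) + B * (s * K)) + B * (s ^ 3 * K))
     + B * Rabs (1 - INR n * m2).
Proof.
  intros Hx Hs HK1 HK3 HB HE HF HF1 Hlip Htay m0 m1 m2.
  pose proof (trunc_positive_linear x M ltac:(lra)) as HA.
  pose proof (trunc_mass_le x M ltac:(lra)) as Hm.
  set (A := trunc x M) in *. set (w := fun k => s * score x k).
  pose proof (stein_iter A HA Hm w F F1 B B B HF HF1 Hlip Htay n 0) as HS.
  replace (A w) with (s * m1) in HS by (symmetry; apply (pl_scal A HA)).
  replace (A (fun k => w k ^ 2)) with m2 in HS.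
  2:{ unfold m2. rewrite <- (pl_scal A HA). apply (pl_ext A HA). intros k. unfold w. ring. }
  replace (A (fun k => Rabs (w k))) with (s * A (fun k => Rabs (score x k))) in HS.
  2:{ rewrite <- (pl_scal A HA). apply (pl_ext A HA). intros k. unfold w.
      rewrite Rabs_mult, (Rabs_pos_eq s) by lra. ring. }
  replace (A (fun k => Rabs (w k) ^ 3)) with (s ^ 3 * A (fun k => Rabs (score x k) ^ 3)) in HS.
  2:{ rewrite <- (pl_scal A HA). apply (pl_ext A HA). intros k. unfold w.
      rewrite Rabs_mult, (Rabs_pos_eq s) by lra. ring. }
  rewrite Rabs_mult, (Rabs_pos_eq s) in HS by lra. fold m0 in HS, Hm.
  rewrite (ie_ext A HA n _ (fun l => lsum w l * F (lsum w l))) in HS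
    by (intros; rewrite Rplus_0_l; auto).
  rewrite (ie_ext A HA n (fun l => F1 (0 + lsum w l)) (fun l => F1 (lsum w l))) in HS
    by (intros; rewrite Rplus_0_l; auto).
  set (a1 := iter_expect A n (fun l => lsum w l * F (lsum w l))) in *.
  set (a2 := iter_expect A n (fun l => F1 (lsum w l))) in *.
  assert (Eq : iter_expect A n (fun l => g (lsum w l)) - c * m0 ^ n = a2 - a1).
  { unfold a2, a1, m0. rewrite <- (ie_const A HA n c), <- !(ie_minus A HA).
    apply (ie_ext A HA). intros l _. rewrite <- HE. ring. }
  rewrite Eq.
  assert (Ha2 : Rabs a2 <= B) by (apply (ie_abs_bound A HA Hm); auto).
  replace (a2 - a1) with (- (a1 - INR n * m2 * a2) + a2 * (1 - INR n * m2)) by ring.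
  eapply Rle_trans; [apply Rabs_triang|]. rewrite Rabs_Ropp, (Rabs_mult a2).
  assert (Hm2 : 0 <= m2).
  { apply Rmult_le_pos; [nra|]. apply (pl_nonneg A HA). intros; apply pow2_ge_0. }
  assert (Hs3 : 0 <= s ^ 3) by (apply pow_le; lra).
  apply Rplus_le_compat; [|apply Rmult_le_compat_r; auto; apply Rabs_pos].
  eapply Rle_trans; [apply HS|]. apply Rmult_le_compat_l; [apply pos_INR|].
  apply Rplus_le_compat; [apply Rplus_le_compat; [lra|]|].
  - apply Rmult_le_compat_l; auto. apply Rplus_le_compat_l, Rmult_le_compat_l; auto.
    apply Rmult_le_compat_l; lra.
  - apply Rmult_le_compat_l; auto. apply Rmult_le_compat_l; auto.
Qed.

Ltac lim_seq_arith :=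
  repeat lazymatch goal with
  | |- is_lim_seq (fun _ => ?c) _ => apply (is_lim_seq_const c)
  | H : is_lim_seq ?u ?l |- is_lim_seq ?u ?l => exact H
  | |- is_lim_seq (fun n => @?a n - @?b n) _ => apply (is_lim_seq_minus' a b)
  | |- is_lim_seq (fun n => @?a n + @?b n) _ => apply (is_lim_seq_plus' a b)
  | |- is_lim_seq (fun n => @?a n * @?b n) _ => apply (is_lim_seq_mult' a b)
  | |- is_lim_seq (fun n => Rabs (@?a n)) (Finite (Rabs ?l)) => apply (is_lim_seq_abs a (Finite l))
  end.

(** The quantifiers carry the uniformity: [K] depends only on the interval, [c] and [B] on [a] and
    [b] besides. The test function lies between the indicators of [(-oo, a]] and [(-oo, b]]; the
    first comparison gives the upper bound on [p], the second the lower one. *)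
Lemma clt_fixed x1 x2 : 0 < x1 -> exists K, 0 <= K /\ forall a b, a < b ->
  exists c B, Phi a <= c <= Phi b /\ 0 <= B /\
  forall x n s (p : R), x1 <= x <= x2 -> 0 < s ->
    let err := INR n * (s ^ 2 * fisher x * (s * K) + s ^ 3 * K) + Rabs (1 - INR n * (s ^ 2 * fisher x)) in
    let P y := is_lim_seq (fun M => iter_expect (trunc x M) n
                 (fun l => ind (Rle_b (lsum (fun k => s * score x k) l) y))) p in
    (P a -> p <= c + B * err) /\ (P b -> c - B * err <= p).
Proof.
  intros H1. destruct (trunc_score_moments x1 x2 H1) as [K [HK0 HK]].
  exists K. split; auto. intros a b Hab.
  destruct (stein_equation a b Hab) as (c & B & F & F1 & g & Hc & HB & Hg & Hga & Hgb & HE & HF & HF1 & Hlip & Htay).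
  exists c, B. split; [|split]; auto. intros x n s p Hx Hs err P.
  set (m0 := fun M => trunc x M (fun _ => 1)).
  set (m1 := fun M => trunc x M (score x)).
  set (m2 := fun M => s ^ 2 * trunc x M (fun k => score x k ^ 2)).
  set (e := fun M => INR n * (B * (s * Rabs (m1 M)) + m2 M * (B * (1 - m0 M) + B * (s * K)) + B * (s ^ 3 * K))
     + B * Rabs (1 - INR n * m2 M)).
  assert (Hm0 : is_lim_seq m0 1) by (apply trunc_mass_cv; lra).
  assert (Hm1 : is_lim_seq m1 0) by (apply trunc_score_cv; lra).
  assert (Hm2 : is_lim_seq m2 (s ^ 2 * fisher x)).
  { apply (is_lim_seq_scal_l _ (s ^ 2) (fisher x)), fisher_cv. lra. }
  (* In the limit the mass is 1 and the score is centred, so the truncation defects drop out of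
     [e]. *)
  assert (He : is_lim_seq e (B * err)).
  { replace (B * err) with
     (INR n * (B * (s * Rabs 0) + s ^ 2 * fisher x * (B * (1 - 1) + B * (s * K)) + B * (s ^ 3 * K))
     + B * Rabs (1 - INR n * (s ^ 2 * fisher x))) by (unfold err; rewrite Rabs_R0; ring).
    unfold e.
    lim_seq_arith. }
  assert (Hcm : is_lim_seq (fun M => c * m0 M ^ n) c).
  { replace (Finite c) with (Finite (c * 1 ^ n)) by (rewrite pow1, Rmult_1_r; auto).
    apply is_lim_seq_mult'; [apply is_lim_seq_const|].
    clear - Hm0. induction n as [|n IH]; simpl; [apply is_lim_seq_const|].
    apply is_lim_seq_mult'; auto. }
  assert (Hb : forall M, Rabs (iter_expect (trunc x M) n (fun l => g (lsum (fun k => s * score x k) l))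
                 - c * m0 M ^ n) <= e M).
  { intros M. destruct (HK x M Hx). apply (clt_truncated x M n s K c B F F1 g); auto. lra. }
  assert (HA : forall M, positive_linear (trunc x M)) by (intros; apply trunc_positive_linear; lra).
  split; intros HP.
  - apply (is_lim_seq_le _ (fun M => c * m0 M ^ n + e M) p (c + B * err)) with (2 := HP).
    + intros M. specialize (Hb M). apply Rabs_le_between in Hb.
      enough (iter_expect (trunc x M) n (fun l => ind (Rle_b (lsum (fun k => s * score x k) l) a))
        <= iter_expect (trunc x M) n (fun l => g (lsum (fun k => s * score x k) l))) by lra.
      apply (ie_le _ (HA M)). intros l _. set (y := lsum _ l).
      destruct (Rle_dec y a).
      * rewrite Rle_b_true, Hga by auto. simpl. lra.
      * rewrite Rle_b_false by lra. simpl. apply Hg.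
    + apply is_lim_seq_plus'; auto.
  - apply (is_lim_seq_le (fun M => c * m0 M ^ n - e M) _ (c - B * err) p) with (3 := HP).
    + intros M. specialize (Hb M). apply Rabs_le_between in Hb.
      enough (iter_expect (trunc x M) n (fun l => g (lsum (fun k => s * score x k) l))
        <= iter_expect (trunc x M) n (fun l => ind (Rle_b (lsum (fun k => s * score x k) l) b))) by lra.
      apply (ie_le _ (HA M)). intros l _. set (y := lsum _ l).
      destruct (Rle_dec y b).
      * rewrite Rle_b_true by auto. simpl. apply Hg.
      * rewrite Rle_b_false, Hgb by lra. simpl. lra.
    + apply is_lim_seq_minus'; auto.
Qed.

Lemma trunc_score'_centred_cv x : 0 < x ->
  is_lim_seq (fun M => trunc x M (fun k => score' x k + fisher x)) 0.
Proof.
  intros Hx.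
  apply (is_lim_seq_ext (fun M => trunc x M (fun k => score' x k + score x k ^ 2)
    - trunc x M (fun k => score x k ^ 2) + fisher x * trunc x M (fun _ => 1))).
  { intros M. pose proof (trunc_positive_linear x M ltac:(lra)) as HA.
    rewrite <- (pl_minus _ HA), <- (pl_scal _ HA), <- (pl_plus _ HA).
    apply (pl_ext _ HA). intros; ring. }
  replace (Finite 0) with (Finite (0 - fisher x + fisher x * 1)) by (f_equal; ring).
  apply is_lim_seq_plus'; [apply is_lim_seq_minus'|apply is_lim_seq_mult'].
  - apply trunc_score'_cv; auto.
  - apply fisher_cv; auto.
  - apply is_lim_seq_const.
  - apply trunc_mass_cv. lra.
Qed.

(** If a cubic part, a centred quadratic part and [u] add up to more than [eta], one of the first
    two reaches [eta / 3]; Markov's inequality treats the first, Chebyshev's the second. The number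
    [u] leaves room for a deterministic mismatch of constants. *)
Lemma remainder_fixed x1 x2 : 0 < x1 -> exists K, 0 <= K /\
  forall x x' n eta u (p : R), x1 <= x <= x2 -> x1 <= x' <= x2 -> 0 < eta -> Rabs u <= eta / 3 ->
  let d := x' - x in
  is_lim_seq (fun M => iter_expect (trunc x M) n (fun l => ind (negb (Rle_b
    (Rabs (lsum (fun k => ln (pmf x' k) - ln (pmf x k) - d * score x k) l
           + d ^ 2 / 2 * (INR n * fisher x) + u)) eta)))) p ->
  p <= K * (INR n * (Rabs d ^ 3 / eta + d ^ 4 / eta ^ 2)).
Proof.
  intros H1. destruct (score_bounds x1 x2 H1) as [C [HC HS]].
  destruct (moment_bound x2 1) as [K1 [HK10 HK1]].
  destruct (moment_bound x2 2) as [K2 [HK20 HK2]].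
  (* Chosen so that [score' + fisher] is at most [E * (1 + |k|)] in absolute value. *)
  set (E := C + C ^ 2 * K2). assert (HC2 : 0 <= C ^ 2) by apply pow2_ge_0.
  assert (HE0 : 0 <= E) by (unfold E; nra).
  assert (HE2 : 0 <= E ^ 2) by apply pow2_ge_0.
  (* The 3 is Markov's inequality at level [eta / 3]; [9 / 4] is [3 ^ 2] times the square of the
     [1 / 2] in [d ^ 2 / 2]. *)
  exists (3 * C * K1 + 9 / 4 * (E ^ 2 * K2)). split; [nra|].
  intros x x' n eta u p Hx Hx' Heta Hu d HP.
  set (J := fisher x) in *.
  assert (HJ : 0 <= J <= C ^ 2 * K2).
  { split; [apply Rlt_le, fisher_pos; lra|].
    apply (is_lim_seq_le (fun M => trunc x M (fun k => score x k ^ 2)) (fun _ => C ^ 2 * K2) J (C ^ 2 * K2)).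
    - intros M. eapply Rle_trans; [apply (trunc_le_moment x M _ (C ^ 2) 2); [lra|]|].
      + intros k. rewrite <- Rpow_mult_distr, <- (pow2_abs (score x k)). apply pow_incr.
        split; [apply Rabs_pos|]. apply (HS x k Hx).
      + apply Rmult_le_compat_l; auto. apply HK2. lra.
    - apply fisher_cv. lra.
    - apply is_lim_seq_const. }
  assert (HA : forall M, positive_linear (trunc x M)) by (intros; apply trunc_positive_linear; lra).
  set (h := fun k => score' x k + J).
  set (W := fun k => 1 + IZR (Z.abs k)).
  set (q := C * Rabs d ^ 3).
  assert (Hq : 0 <= q) by (apply Rmult_le_pos; auto; apply pow_le, Rabs_pos).
  assert (Hpt : forall l, length l = n ->
    ind (negb (Rle_b (Rabs (lsum (fun k => ln (pmf x' k) - ln (pmf x k) - d * score x k) l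
           + d ^ 2 / 2 * (INR n * J) + u)) eta))
    <= 3 / eta * q * lsum W l + 9 / eta ^ 2 * (d ^ 4 / 4) * lsum h l ^ 2).
  { intros l Hl.
    assert (HW : Rabs (lsum (fun k => ln (pmf x' k) - ln (pmf x k) - d * score x k - d ^ 2 / 2 * score' x k) l)
             <= q * lsum W l).
    { rewrite <- lsum_scal. apply lsum_abs. intros k. unfold d, q, W.
      assert (Hsub : forall t, Rmin x x' <= t <= Rmax x x' -> x1 <= t <= x2).
      { intros t. unfold Rmin, Rmax. destruct (Rle_dec x x'); lra. }
      eapply Rle_trans.
      - apply (taylor3_abs (fun y => ln (pmf y k)) (fun y => score y k) (fun y => score' y k)
          (fun y => score'' y k) x x' (C * (1 + IZR (Z.abs k)))); intros t Ht; apply Hsub in Ht.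
        + apply is_derive_ln_pmf; lra.
        + apply is_derive_score; lra.
        + apply is_derive_score'; lra.
        + apply (HS t k Ht).
      - fold d. apply Req_le. ring. }
    set (a := lsum (fun k => ln (pmf x' k) - ln (pmf x k) - d * score x k - d ^ 2 / 2 * score' x k) l) in *.
    replace (lsum (fun k => ln (pmf x' k) - ln (pmf x k) - d * score x k) l + d ^ 2 / 2 * (INR n * J) + u)
      with (a + d ^ 2 / 2 * lsum h l + u).
    2:{ unfold h. rewrite lsum_plus, lsum_const, Hl.
        rewrite (lsum_ext (fun k => ln (pmf x' k) - ln (pmf x k) - d * score x k)
          (fun k => (ln (pmf x' k) - ln (pmf x k) - d * score x k - d ^ 2 / 2 * score' x k)
             + d ^ 2 / 2 * score' x k)) by (intros; ring).
        rewrite lsum_plus, lsum_scal. fold a. ring. }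
    set (bq := d ^ 2 / 2 * lsum h l).
    replace (9 / eta ^ 2 * (d ^ 4 / 4) * lsum h l ^ 2) with ((3 / eta * bq) ^ 2)
      by (unfold bq; field; lra).
    assert (H3 : 0 < 3 / eta) by (apply Rdiv_lt_0_compat; lra).
    pose proof (pow2_ge_0 (3 / eta * bq)).
    assert (0 <= 3 / eta * q * lsum W l).
    { rewrite Rmult_assoc. apply Rmult_le_pos; [lra|]. eapply Rle_trans; [apply Rabs_pos|apply HW]. }
    destruct (Rle_dec (Rabs (a + bq + u)) eta) as [Hle|Hgt].
    - rewrite Rle_b_true by auto. simpl ind. lra.
    - rewrite Rle_b_false by lra. simpl ind.
      destruct (Rle_dec (eta / 3) (q * lsum W l)) as [Hc|Hc].
      + assert (1 <= 3 / eta * (q * lsum W l)); [|lra].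
        replace 1 with (3 / eta * (eta / 3)) by (field; lra). apply Rmult_le_compat_l; lra.
      + assert (Hbq : eta / 3 <= Rabs bq).
        { pose proof (Rabs_triang (a + bq) u). pose proof (Rabs_triang a bq). lra. }
        assert (1 <= (3 / eta * bq) ^ 2); [|lra].
        rewrite <- pow2_abs, Rabs_mult, (Rabs_pos_eq (3 / eta)) by lra.
        assert (1 <= 3 / eta * Rabs bq); [|nra].
        replace 1 with (3 / eta * (eta / 3)) by (field; lra). apply Rmult_le_compat_l; lra. }
  set (m1 := fun M => trunc x M h).
  assert (Hm1 : is_lim_seq m1 0) by (apply trunc_score'_centred_cv; lra).
  (* The factor [n ^ 2 * d ^ 4] is of order one in the application; only the exact centring in the
     limit, [m1 M -> 0], removes this term. *)
  set (U := fun M => 3 / eta * q * (INR n * K1)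
      + 9 / eta ^ 2 * (d ^ 4 / 4) * (INR n * (E ^ 2 * K2) + INR n ^ 2 * (m1 M * m1 M))).
  assert (HU : is_lim_seq U (3 / eta * q * (INR n * K1)
      + 9 / eta ^ 2 * (d ^ 4 / 4) * (INR n * (E ^ 2 * K2) + INR n ^ 2 * (0 * 0)))).
  { unfold U. lim_seq_arith. }
  pose proof (pos_INR n) as Hn.
  assert (H3 : 0 < 3 / eta) by (apply Rdiv_lt_0_compat; lra).
  assert (H9 : 0 <= 9 / eta ^ 2 * (d ^ 4 / 4)).
  { apply Rmult_le_pos; [apply Rlt_le, Rdiv_lt_0_compat; nra|].
    replace (d ^ 4 / 4) with ((d ^ 2 / 2) ^ 2) by field. apply pow2_ge_0. }
  apply Rle_trans with (3 / eta * q * (INR n * K1)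
      + 9 / eta ^ 2 * (d ^ 4 / 4) * (INR n * (E ^ 2 * K2) + INR n ^ 2 * (0 * 0))).
  - apply (is_lim_seq_le _ U p _) with (2 := HP) (3 := HU). intros M.
    eapply Rle_trans; [apply (ie_le _ (HA M)); intros l Hl; apply (Hpt l Hl)|].
    rewrite (ie_plus _ (HA M) n (fun l => _ * lsum W l) (fun l => _ * lsum h l ^ 2)), !(ie_scal _ (HA M)).
    pose proof (trunc_mass_le x M ltac:(lra)) as Hmass.
    assert (HWpos : forall k, 0 <= W k) by (intros k; pose proof (one_plus_abs_le k); unfold W; lra).
    unfold U. apply Rplus_le_compat; apply Rmult_le_compat_l; auto; [nra| |].
    + eapply Rle_trans; [apply (ie_lsum_le _ (HA M) Hmass); auto|].
      apply Rmult_le_compat_l; auto.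
      eapply Rle_trans; [|apply (HK1 x M); lra]. apply (pl_le _ (HA M)). intros k. unfold W. lra.
    + eapply Rle_trans; [apply (ie_lsum_sq _ (HA M) Hmass)|]. fold (m1 M).
      replace (m1 M * m1 M) with (m1 M ^ 2) by ring.
      apply Rplus_le_compat_r. apply Rmult_le_compat_l; auto.
      eapply Rle_trans; [apply (trunc_le_moment x M _ (E ^ 2) 2); [lra|]|].
      * intros k. rewrite <- Rpow_mult_distr, <- (pow2_abs (h k)). apply pow_incr.
        split; [apply Rabs_pos|]. unfold h. eapply Rle_trans; [apply Rabs_triang|].
        rewrite (Rabs_pos_eq J) by lra. destruct (HS x k Hx) as [_ [S1 _]].
        pose proof (one_plus_abs_le k). unfold E. nra.
      * apply Rmult_le_compat_l; auto. apply HK2. lra.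
  - assert (Hd4 : 0 <= d ^ 4 / eta ^ 2).
    { apply Rmult_le_pos; [replace (d ^ 4) with ((d ^ 2) ^ 2) by ring; apply pow2_ge_0|].
      apply Rlt_le, Rinv_0_lt_compat; nra. }
    assert (Hd3 : 0 <= Rabs d ^ 3 / eta).
    { apply Rmult_le_pos; [apply pow_le, Rabs_pos|apply Rlt_le, Rinv_0_lt_compat; auto]. }
    replace (3 / eta * q * (INR n * K1)) with (3 * C * K1 * (INR n * (Rabs d ^ 3 / eta)))
      by (unfold q; field; lra).
    replace (9 / eta ^ 2 * (d ^ 4 / 4) * (INR n * (E ^ 2 * K2) + INR n ^ 2 * (0 * 0)))
      with (9 / 4 * (E ^ 2 * K2) * (INR n * (d ^ 4 / eta ^ 2))) by (field; lra).
    assert (0 <= 3 * C * K1) by nra. assert (0 <= 9 / 4 * (E ^ 2 * K2)) by nra.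
    assert (0 <= INR n * (Rabs d ^ 3 / eta)) by nra. assert (0 <= INR n * (d ^ 4 / eta ^ 2)) by nra.
    nra.
Qed.

(** * Long-time asymptotics *)

Lemma is_lim_mult_finite f g (x : Rbar) (lf lg : R) :
  is_lim f x lf -> is_lim g x lg -> is_lim (fun y => f y * g y) x (lf * lg).
Proof. intros Hf Hg. apply (is_lim_mult f g x lf lg Hf Hg). exact I. Qed.

Lemma lim_T_is_lim u (l : R) : lim_T u l <-> is_lim u p_infty l.
Proof.
  rewrite <- is_lim_spec. split.
  - intros H eps. destruct (H eps (cond_pos eps)) as [T0 HT]. exists T0. intros T HTT.
    apply HT. lra.
  - intros H eps Heps. destruct (H (mkposreal eps Heps)) as [M HM]. exists (M + 1). intros T HT.
    apply HM. lra.
Qed.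

Lemma lim_T_eventually u (l : R) (P : R -> Prop) : lim_T u l ->
  (exists eps, eps > 0 /\ forall y, Rabs (y - l) < eps -> P y) ->
  exists T0, forall T, T >= T0 -> P (u T).
Proof. intros H [eps [Heps HP]]. destruct (H eps Heps) as [T0 HT]. exists T0. auto. Qed.

Lemma diffs_psums s k : diffs (s :: psums s k) = k.
Proof.
  revert s. induction k as [|a k IH]; intros s; [reflexivity|].
  change (diffs (s :: psums s (a :: k)))
    with ((s + a - s)%Z :: diffs ((s + a)%Z :: psums (s + a) k)).
  rewrite IH. f_equal. lia.
Qed.

Lemma length_obs k : length (obs k) = S (length k).
Proof.
  unfold obs. simpl. f_equal. generalize 0%Z. induction k; intros; simpl; auto.
Qed.

Lemma law_pmf_obs T Delta theta k : length k = nobs T Delta ->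
  law_pmf T Delta theta (obs k) = prod_f Delta theta k.
Proof.
  intros Hk. unfold law_pmf. rewrite length_obs, Hk, Nat.eqb_refl.
  unfold obs. rewrite diffs_psums. reflexivity.
Qed.

Lemma prod_f_pos Delta theta k : 0 < theta * Delta -> 0 < prod_f Delta theta k.
Proof.
  intros H. induction k as [|a k IH]; simpl; [lra|].
  apply Rmult_lt_0_compat; auto. apply (pmf_pos (theta * Delta) a H).
Qed.

Lemma ln_prod_f Delta theta k : 0 < theta * Delta ->
  ln (prod_f Delta theta k) = lsum (fun a => ln (pmf (theta * Delta) a)) k.
Proof.
  intros H. induction k as [|a k IH]; simpl; [apply ln_1|].
  rewrite ln_mult; [|apply (pmf_pos (theta * Delta) a H)|apply prod_f_pos; auto].
  rewrite IH. reflexivity.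
Qed.

Lemma nobs_bounds T Delta : 0 < T -> 0 < Delta ->
  T / Delta - 1 <= INR (nobs T Delta) <= T / Delta.
Proof.
  intros HT HD. destruct (base_Int_part (T / Delta)) as [H1 H2].
  assert (0 < T / Delta) by (apply Rdiv_lt_0_compat; auto).
  assert (Hz : (0 <= Int_part (T / Delta))%Z).
  { assert (-1 < Int_part (T / Delta))%Z; [|lia]. apply lt_IZR. lra. }
  unfold nobs. rewrite INR_IZR_INZ, Z2Nat.id by auto. lra.
Qed.

Lemma fisher_continuous x : 0 < x -> continuous fisher x.
Proof.
  intros Hx. destruct (fisher_lipschitz (x / 2) (2 * x) ltac:(lra)) as [K HK].
  apply continuity_pt_filterlim. intros eps Heps.
  assert (HK1 : 0 < Rabs K + 1) by (pose proof (Rabs_pos K); lra).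
  exists (Rmin (x / 2) (eps / (Rabs K + 1))). split.
  { apply Rmin_pos; [lra|]. apply Rdiv_lt_0_compat; lra. }
  intros y [_ Hy]. simpl in *. unfold R_dist in *.
  pose proof (Rmin_l (x / 2) (eps / (Rabs K + 1))). pose proof (Rmin_r (x / 2) (eps / (Rabs K + 1))).
  assert (Hy2 : Rabs (y - x) < x / 2) by lra. apply Rabs_def2 in Hy2.
  eapply Rle_lt_trans; [apply HK; lra|].
  assert (Rabs (y - x) * (Rabs K + 1) < eps) by (apply Rlt_div_r; lra).
  pose proof (Rle_abs K). pose proof (Rabs_pos (y - x)). nra.
Qed.

Section Asymptotics.
Variables (DeltaT : R -> R) (Dinf theta : R).
Hypothesis DeltaT_pos : forall T, T > 0 -> DeltaT T > 0.
Hypothesis Dinf_pos : 0 < Dinf.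
Hypothesis DeltaT_lim : lim_T DeltaT Dinf.
Hypothesis theta_pos : 0 < theta.

Let x0 := theta * Dinf.
Let info T := T * Dinf * fisher x0.
Let step T := DeltaT T / sqrt (info T).
Let num T := INR (nobs T (DeltaT T)).

Let x0_pos : 0 < x0.
Proof. apply Rmult_lt_0_compat; auto. Qed.

Lemma info_pos T : T > 0 -> info T > 0.
Proof.
  intros HT. unfold info. pose proof (fisher_pos x0 x0_pos).
  repeat apply Rmult_gt_0_compat; auto.
Qed.

Lemma step_pos T : T > 0 -> 0 < step T.
Proof.
  intros HT. apply Rdiv_lt_0_compat; [apply DeltaT_pos; auto|].
  apply sqrt_lt_R0, info_pos; auto.
Qed.

Lemma step_sq T : T > 0 -> step T ^ 2 = DeltaT T ^ 2 / info T.
Proof.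
  intros HT. pose proof (info_pos T HT). unfold step.
  replace ((DeltaT T / sqrt (info T)) ^ 2) with (DeltaT T ^ 2 / (sqrt (info T) ^ 2))
    by (field; apply Rgt_not_eq, sqrt_lt_R0; auto).
  rewrite pow2_sqrt by lra. reflexivity.
Qed.

Lemma lim_DeltaT : is_lim DeltaT p_infty Dinf.
Proof. apply lim_T_is_lim, DeltaT_lim. Qed.

Lemma lim_x : is_lim (fun T => theta * DeltaT T) p_infty x0.
Proof. apply (is_lim_scal_l DeltaT theta p_infty Dinf), lim_DeltaT. Qed.

Lemma lim_fisher : is_lim (fun T => fisher (theta * DeltaT T)) p_infty (fisher x0).
Proof.
  apply (is_lim_comp_continuous (fun T => theta * DeltaT T) fisher); [apply lim_x|].
  apply fisher_continuous, x0_pos.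
Qed.

Lemma lim_inv_T : is_lim (fun T => / T) p_infty 0.
Proof. apply (is_lim_inv (fun T => T) p_infty p_infty); [apply is_lim_id|discriminate]. Qed.

(** Rounding [T / DeltaT T] down loses at most one observation, a relative error of
    [DeltaT T / T]. *)
Lemma lim_num : is_lim (fun T => num T * DeltaT T / T) p_infty 1.
Proof.
  apply (is_lim_le_le_loc (fun T => 1 - DeltaT T * / T) (fun _ => 1)).
  - exists 0. intros T HT. pose proof (DeltaT_pos T HT) as HD.
    destruct (nobs_bounds T (DeltaT T) HT HD) as [H1 H2]. fold (num T) in H1, H2.
    apply (Rmult_le_compat_r (DeltaT T / T)) in H1; [|apply Rlt_le, Rdiv_lt_0_compat; auto].
    apply (Rmult_le_compat_r (DeltaT T / T)) in H2; [|apply Rlt_le, Rdiv_lt_0_compat; auto].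
    replace ((T / DeltaT T - 1) * (DeltaT T / T)) with (1 - DeltaT T * / T) in H1 by (field; lra).
    replace (T / DeltaT T * (DeltaT T / T)) with 1 in H2 by (field; lra).
    unfold Rdiv in *. lra.
  - replace (Finite 1) with (Finite (1 - Dinf * 0)) by (f_equal; ring).
    apply is_lim_minus'; [apply is_lim_const|].
    apply is_lim_mult_finite; [apply lim_DeltaT|apply lim_inv_T].
  - apply is_lim_const.
Qed.

(** [num] is about [T / Dinf] and [step ^ 2] about [Dinf / (T * fisher x0)]. Later error terms are
    this bounded product times further powers of [step], or deviations of the variance from one. *)
Lemma lim_num_step : is_lim (fun T => num T * step T ^ 2) p_infty (/ fisher x0).
Proof.
  pose proof (fisher_pos x0 x0_pos).
  apply (is_lim_ext_loc (fun T => num T * DeltaT T / T * (DeltaT T * / (Dinf * fisher x0)))).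
  - exists 0. intros T HT. rewrite step_sq by auto. unfold info. field. lra.
  - replace (Finite (/ fisher x0)) with (Finite (1 * (Dinf * / (Dinf * fisher x0))))
      by (f_equal; field; lra).
    apply is_lim_mult_finite; [apply lim_num|]. apply is_lim_mult_finite; [apply lim_DeltaT|apply is_lim_const].
Qed.

Lemma lim_step : is_lim step p_infty 0.
Proof.
  pose proof (fisher_pos x0 x0_pos).
  apply (is_lim_ext_loc (fun T => sqrt (DeltaT T * DeltaT T * / T * / (Dinf * fisher x0)))).
  - exists 0. intros T HT. pose proof (step_pos T HT).
    replace (DeltaT T * DeltaT T * / T * / (Dinf * fisher x0)) with (step T ^ 2).
    + apply sqrt_pow2. lra.
    + rewrite step_sq by auto. unfold info. field. lra.
  - replace (Finite 0) with (Finite (sqrt (Dinf * Dinf * 0 * / (Dinf * fisher x0))))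
      by (rewrite Rmult_0_r, Rmult_0_l, sqrt_0; auto).
    apply (is_lim_comp_continuous (fun T => DeltaT T * DeltaT T * / T * / (Dinf * fisher x0)) sqrt).
    + repeat apply is_lim_mult_finite; try apply lim_DeltaT; try apply is_lim_const. apply lim_inv_T.
    + apply continuity_pt_filterlim, continuity_pt_sqrt. rewrite Rmult_0_r, Rmult_0_l. lra.
Qed.

(** The limiting variance of the central sequence; continuity of [fisher] replaces the information
    at the actual spacing by that at [Dinf]. *)
Lemma lim_num_step_fisher :
  is_lim (fun T => num T * step T ^ 2 * fisher (theta * DeltaT T)) p_infty 1.
Proof.
  pose proof (fisher_pos x0 x0_pos).
  replace (Finite 1) with (Finite (/ fisher x0 * fisher x0)) by (f_equal; field; lra).
  apply is_lim_mult_finite; [apply lim_num_step|apply lim_fisher].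
Qed.

Lemma eventually_x_in : exists T0, forall T, T >= T0 -> x0 / 2 <= theta * DeltaT T <= 2 * x0.
Proof.
  apply (lim_T_eventually (fun T => theta * DeltaT T) x0 (fun y => x0 / 2 <= y <= 2 * x0)).
  - apply lim_T_is_lim, lim_x.
  - exists (x0 / 2). pose proof x0_pos. split; [lra|]. intros y Hy. apply Rabs_def2 in Hy. lra.
Qed.

Lemma eventually_x'_in v : exists T0, forall T, T >= T0 ->
  x0 / 2 <= theta * DeltaT T + v * step T <= 2 * x0.
Proof.
  apply (lim_T_eventually (fun T => theta * DeltaT T + v * step T) x0 (fun y => x0 / 2 <= y <= 2 * x0)).
  - apply lim_T_is_lim. replace (Finite x0) with (Finite (x0 + v * 0)) by (f_equal; ring).
    apply is_lim_plus'; [apply lim_x|]. apply is_lim_mult_finite; [apply is_lim_const|apply lim_step].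
  - exists (x0 / 2). pose proof x0_pos. split; [lra|]. intros y Hy. apply Rabs_def2 in Hy. lra.
Qed.

Lemma info_equivalent :
  lim_T (fun T => T * DeltaT T * fisher (theta * DeltaT T) / info T) 1.
Proof.
  pose proof (fisher_pos x0 x0_pos). apply lim_T_is_lim.
  apply (is_lim_ext_loc (fun T => DeltaT T * fisher (theta * DeltaT T) * / (Dinf * fisher x0))).
  - exists 0. intros T HT. unfold info. field. lra.
  - replace (Finite 1) with (Finite (Dinf * fisher x0 * / (Dinf * fisher x0))) by (f_equal; field; lra).
    apply is_lim_mult_finite; [|apply is_lim_const]. apply is_lim_mult_finite; [apply lim_DeltaT|apply lim_fisher].
Qed.

(** The score is evaluated at the actual spacing [DeltaT T]; only the information in the
    normalisation is frozen at [Dinf]. *)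
Definition central_sequence (T : R) (o : list Z) : R :=
  lsum (fun k => DeltaT T / sqrt (T * Dinf * fisher (theta * Dinf)) * score (theta * DeltaT T) k) (diffs o).

Lemma central_sequence_obs T k :
  central_sequence T (obs k) = lsum (fun a => step T * score (theta * DeltaT T) a) k.
Proof. unfold central_sequence, obs. rewrite diffs_psums. reflexivity. Qed.

Lemma central_sequence_normal : conv_dist_std_normal DeltaT theta central_sequence.
Proof.
  intros y eps Heps. pose proof x0_pos as Hx0.
  destruct (clt_fixed (x0 / 2) (2 * x0) ltac:(lra)) as [K [HK Hclt]].
  (* The indicator is smoothed over a window of length [eps / 2] on either side of [y]; as [Phi] is
     1-Lipschitz, each window costs at most [eps / 2]. *)
  destruct (Hclt y (y + eps / 2) ltac:(lra)) as (c1 & B1 & Hc1 & HB1 & Hup).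
  destruct (Hclt (y - eps / 2) y ltac:(lra)) as (c2 & B2 & Hc2 & HB2 & Hlow).
  set (err := fun T => num T * (step T ^ 2 * fisher (theta * DeltaT T) * (step T * K) + step T ^ 3 * K)
        + Rabs (1 - num T * (step T ^ 2 * fisher (theta * DeltaT T)))).
  assert (Herr : lim_T err 0).
  { apply lim_T_is_lim. pose proof (fisher_pos x0 x0_pos).
    apply (is_lim_ext (fun T => num T * step T ^ 2 * fisher (theta * DeltaT T) * (step T * K)
        + num T * step T ^ 2 * (step T * K)
        + Rabs (1 - num T * step T ^ 2 * fisher (theta * DeltaT T)))).
    { intros T. unfold err.
      rewrite <- (Rmult_assoc (num T) (step T ^ 2) (fisher (theta * DeltaT T))). ring. }
    replace (Finite 0) with (Finite (1 * (0 * K) + / fisher x0 * (0 * K) + Rabs (1 - 1)))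
      by (f_equal; rewrite Rminus_diag, Rabs_R0; ring).
    apply is_lim_plus'; [apply is_lim_plus'|].
    - apply is_lim_mult_finite; [apply lim_num_step_fisher|].
      apply is_lim_mult_finite; [apply lim_step|apply is_lim_const].
    - apply is_lim_mult_finite; [apply lim_num_step|].
      apply is_lim_mult_finite; [apply lim_step|apply is_lim_const].
    - apply (is_lim_comp_continuous (fun T => 1 - num T * step T ^ 2 * fisher (theta * DeltaT T)) Rabs);
        [|apply continuous_Rabs].
      apply is_lim_minus'; [apply is_lim_const|].
      apply lim_num_step_fisher. }
  (* The extra 1 keeps the divisor positive even if both constants vanish. *)
  set (B := B1 + B2 + 1).
  destruct (Herr (eps / (2 * B))) as [T1 HT1].
  { apply Rdiv_lt_0_compat; unfold B; lra. }
  destruct eventually_x_in as [T2 HT2].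
  exists (Rmax 1 (Rmax T1 T2)). intros T HT.
  pose proof (Rmax_l 1 (Rmax T1 T2)). pose proof (Rmax_r 1 (Rmax T1 T2)).
  pose proof (Rmax_l T1 T2). pose proof (Rmax_r T1 T2).
  specialize (HT1 T ltac:(lra)). specialize (HT2 T ltac:(lra)).
  set (p := expect T (DeltaT T) theta (fun o => ind (Rle_b (central_sequence T o) y))).
  assert (HP : is_lim_seq (fun M => iter_expect (trunc (theta * DeltaT T) M) (nobs T (DeltaT T))
     (fun l => ind (Rle_b (lsum (fun k => step T * score (theta * DeltaT T) k) l) y))) p).
  { eapply is_lim_seq_ext; [|apply expect_cv].
    - intros M. apply ie_ext; [apply trunc_positive_linear; lra|].
      intros l _. cbv beta. rewrite central_sequence_obs. reflexivity.
    - lra.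
    - intros l. apply ind_bounds. }
  destruct (Hup (theta * DeltaT T) (nobs T (DeltaT T)) (step T) p HT2 (step_pos T ltac:(lra))) as [U _].
  destruct (Hlow (theta * DeltaT T) (nobs T (DeltaT T)) (step T) p HT2 (step_pos T ltac:(lra))) as [_ V].
  specialize (U HP). specialize (V HP). fold (num T) in U, V. fold (err T) in U, V.
  pose proof (Phi_incr y (y + eps / 2) ltac:(lra)). pose proof (Phi_incr (y - eps / 2) y ltac:(lra)).
  rewrite Rminus_0_r in HT1.
  assert (Hlt : B * Rabs (err T) < eps / 2).
  { replace (eps / 2) with (B * (eps / (2 * B))) by (field; unfold B; lra).
    apply Rmult_lt_compat_l; auto. unfold B; lra. }
  pose proof (Rle_abs (err T)). pose proof (Rabs_pos (err T)).
  assert (B1 * err T <= B * Rabs (err T)) by (unfold B; nra).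
  assert (B2 * err T <= B * Rabs (err T)) by (unfold B; nra).
  apply Rabs_def1; lra.
Qed.

(** Defined as what is left of the log-likelihood ratio, so the LAN identity holds by construction
    and the whole content is that it vanishes. *)
Definition log_lik_remainder (v T : R) (o : list Z) : R :=
  ln (lik_ratio T (DeltaT T) (theta + v / sqrt (T * Dinf * fisher (theta * Dinf))) theta o)
  - (v * central_sequence T o - / 2 * v ^ 2).

Lemma log_lik_remainder_obs v T k : T > 0 -> 0 < theta * DeltaT T + v * step T ->
  length k = nobs T (DeltaT T) ->
  let x := theta * DeltaT T in let x' := x + v * step T in
  log_lik_remainder v T (obs k)
  = lsum (fun a => ln (pmf x' a) - ln (pmf x a) - (x' - x) * score x a) k + / 2 * v ^ 2.
Proof.
  intros HT Hx' Hk x x'. unfold log_lik_remainder. fold x0 (info T).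
  assert (Hx : 0 < x) by (apply Rmult_lt_0_compat; [auto|apply DeltaT_pos; auto]).
  assert (Ex' : (theta + v / sqrt (info T)) * DeltaT T = x').
  { unfold x', x, step. field. apply Rgt_not_eq, sqrt_lt_R0, info_pos; auto. }
  unfold lik_ratio. rewrite !law_pmf_obs by auto.
  rewrite ln_div by (apply prod_f_pos; rewrite ?Ex'; auto).
  rewrite !ln_prod_f by (rewrite ?Ex'; auto). rewrite Ex', central_sequence_obs. fold x.
  rewrite (lsum_ext (fun a => ln (pmf x' a) - ln (pmf x a) - (x' - x) * score x a)
    (fun a => ln (pmf x' a) + ((-1) * ln (pmf x a)
     + (-1) * ((v * step T) * score x a)))) by (intros; unfold x'; ring).
  rewrite !lsum_plus, !lsum_scal. ring.
Qed.

Lemma log_lik_remainder_vanishes v : conv_prob_zero DeltaT theta (log_lik_remainder v).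
Proof.
  intros eta Heta eps Heps. pose proof x0_pos as Hx0. pose proof (fisher_pos x0 x0_pos) as HJ0.
  destruct (remainder_fixed (x0 / 2) (2 * x0) ltac:(lra)) as [K [HK Hrem]].
  (* The quadratic term of the expansion is centred at [num * step ^ 2 * fisher x * v ^ 2 / 2]
     instead of [v ^ 2 / 2]; [u] is the difference. *)
  set (u := fun T => / 2 * v ^ 2 * (1 - num T * step T ^ 2 * fisher (theta * DeltaT T))).
  assert (Hu : lim_T u 0).
  { apply lim_T_is_lim. unfold u.
    replace (Finite 0) with (Finite (/ 2 * v ^ 2 * (1 - 1))) by (f_equal; ring).
    apply is_lim_mult_finite; [apply is_lim_const|].
    apply is_lim_minus'; [apply is_lim_const|apply lim_num_step_fisher]. }
  set (e := fun T => K * (num T * (Rabs (v * step T) ^ 3 / eta + (v * step T) ^ 4 / eta ^ 2))).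
  assert (He : lim_T e 0).
  { apply lim_T_is_lim.
    apply (is_lim_ext_loc (fun T => K * (num T * step T ^ 2 *
      (Rabs v ^ 3 / eta * step T + v ^ 4 / eta ^ 2 * (step T * step T))))).
    - exists 0. intros T HT. pose proof (step_pos T HT). unfold e.
      rewrite Rabs_mult, (Rabs_pos_eq (step T)) by lra. field. lra.
    - replace (Finite 0) with (Finite (K * (/ fisher x0 * (Rabs v ^ 3 / eta * 0 + v ^ 4 / eta ^ 2 * (0 * 0)))))
        by (f_equal; ring).
      apply is_lim_mult_finite; [apply is_lim_const|]. apply is_lim_mult_finite; [apply lim_num_step|].
      apply is_lim_plus'; apply is_lim_mult_finite; try apply is_lim_const; try apply lim_step.
      apply is_lim_mult_finite; apply lim_step. }
  destruct (Hu (eta / 3) ltac:(lra)) as [T1 HT1].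
  destruct (He eps Heps) as [T2 HT2].
  (* Convergence in probability is claimed for every [v], without asking that the shifted parameter
     lie in [Theta]; that it is positive comes from [T] being large. *)
  destruct eventually_x_in as [T3 HT3]. destruct (eventually_x'_in v) as [T4 HT4].
  exists (Rmax 1 (Rmax (Rmax T1 T2) (Rmax T3 T4))). intros T HT.
  pose proof (Rmax_l 1 (Rmax (Rmax T1 T2) (Rmax T3 T4))).
  pose proof (Rmax_r 1 (Rmax (Rmax T1 T2) (Rmax T3 T4))).
  pose proof (Rmax_l (Rmax T1 T2) (Rmax T3 T4)). pose proof (Rmax_r (Rmax T1 T2) (Rmax T3 T4)).
  pose proof (Rmax_l T1 T2). pose proof (Rmax_r T1 T2).
  pose proof (Rmax_l T3 T4). pose proof (Rmax_r T3 T4).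
  specialize (HT1 T ltac:(lra)). specialize (HT2 T ltac:(lra)).
  specialize (HT3 T ltac:(lra)). specialize (HT4 T ltac:(lra)).
  rewrite Rminus_0_r in *.
  set (p := expect T (DeltaT T) theta
    (fun o => ind (negb (Rle_b (Rabs (log_lik_remainder v T o)) eta)))).
  set (x := theta * DeltaT T) in *. set (x' := x + v * step T) in *.
  assert (HA : forall M, positive_linear (trunc x M)) by (intros; apply trunc_positive_linear; lra).
  assert (Hp := expect_cv T (DeltaT T) theta
    (fun o => ind (negb (Rle_b (Rabs (log_lik_remainder v T o)) eta))) ltac:(fold x; lra)
    ltac:(intros; apply ind_bounds)). fold x p in Hp.
  assert (Hp0 : 0 <= p).
  { apply (is_lim_seq_le (fun _ => 0) _ 0 p) with (2 := is_lim_seq_const 0) (3 := Hp).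
    intros M. replace 0 with (iter_expect (trunc x M) (nobs T (DeltaT T)) (fun _ => 0)).
    - apply ie_le; auto. intros; apply ind_bounds.
    - rewrite ie_const by auto. ring. }
  assert (Hp1 : p <= e T).
  { unfold e. replace (v * step T) with (x' - x) by (unfold x'; ring).
    apply (Hrem x x' (nobs T (DeltaT T)) eta (u T) p); auto; [lra|].
    eapply is_lim_seq_ext; [|apply Hp]. intros M. apply ie_ext; auto. intros l Hl. cbv beta.
    assert (Hpos : 0 < theta * DeltaT T + v * step T) by (change (0 < x'); lra).
    rewrite (log_lik_remainder_obs v T l ltac:(lra) Hpos Hl). cbv zeta. fold x x'.
    replace (/ 2 * v ^ 2) with ((x' - x) ^ 2 / 2 * (INR (nobs T (DeltaT T)) * fisher x) + u T).
    - rewrite <- Rplus_assoc. reflexivity.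
    - unfold u. fold x. unfold x'. fold (num T). field. }
  rewrite Rabs_pos_eq by auto. pose proof (Rle_abs (e T)). lra.
Qed.

End Asymptotics.

Theorem theorem1 (Theta : R -> Prop) (DeltaT : R -> R) (Dinf : R) :
  open_param_set Theta ->
  (forall T, T > 0 -> DeltaT T > 0) ->
  0 < Dinf ->
  lim_T DeltaT Dinf ->
  forall theta, Theta theta ->
    LAN Theta DeltaT theta (fun T => T * Dinf * phi theta Dinf) /\
    lim_T (fun T => (T * DeltaT T * phi theta (DeltaT T))
                    / (T * Dinf * phi theta Dinf)) 1.
Proof.
  intros HTheta HD HDinf Hlim theta Hth.
  assert (Htheta : 0 < theta) by apply (HTheta theta Hth).
  split; [split|].
  - intros T HT. apply (info_pos Dinf theta HDinf Htheta T HT).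
  - exists (central_sequence DeltaT Dinf theta), (log_lik_remainder DeltaT Dinf theta).
    split; [|split].
    (* The identity is due for every [T > 0], not only large ones; the shifted parameter is positive
       because it lies in [Theta], so the ratio is positive and [exp] undoes [ln]. *)
    + intros v T HT Hv k Hk. unfold log_lik_remainder. rewrite !phi_fisher in *.
      replace (v * _ - _ + _) with (ln (lik_ratio T (DeltaT T)
        (theta + v / sqrt (T * Dinf * fisher (theta * Dinf))) theta (obs k))) by ring.
      symmetry. apply exp_ln. unfold lik_ratio. rewrite !law_pmf_obs by auto.
      pose proof (HD T HT). pose proof (proj1 (HTheta _ Hv)).
      apply Rdiv_lt_0_compat; apply prod_f_pos, Rmult_lt_0_compat; auto.
    + apply central_sequence_normal; auto.
    + apply log_lik_remainder_vanishes; auto.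
  - apply info_equivalent; auto.
Qed.
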